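(* Let $\mathbb K=\mathbb Q_p$ and let $\mathcal T$ be the Bruhat–Tits tree of $\mathbb K$, with boundary (set of ends) identified with $\mathbb P\mathbb K^1$. Any rational map $f:\mathbb P\mathbb K^1\to\mathbb P\mathbb K^1$ (defined over $\mathbb K$) can be extended to a continuous map of Bruhat–Tits trees such that the image of a vertex is a vertex and the image of an edge is an edge or a vertex. That is, there is a continuous map $F:|\mathcal T|\cup\mathbb P\mathbb K^1\to|\mathcal T|\cup\mathbb P\mathbb K^1$ with $F(|\mathcal T|)\subset|\mathcal T|$, $F|_{\mathbb P\mathbb K^1}=f$, mapping each vertex to a vertex and each edge onto an edge or to a vertex.
   Context: Let $\mathbb O=\mathbb Z_p$. A lattice in $\mathbb K^2$ is a compact $\mathbb O$-submodule $R$ with $\mathbb K\cdot R=\mathbb K^2$. The Bruhat–Tits tree $\mathcal T=\mathrm{BT}^*_2(\mathbb K)$ is the graph whose vertices are lattices in $\mathbb K^2$ up to dilatations $R\sim\lambda R$, $\lambda\in\mathbb K^\times$; two distinct vertices, represented by $R$ and $T$, are joined by an edge if $pT\subset\lambda R\subset T$ for some $\lambda\in\mathbb K^\times$. It is an infinite tree in which each vertex has $p+1$ neighbors; $|\mathcal T|$ denotes its geometric realization. The ends of $\mathcal T$ are in bijection with lines $\ell\subset\mathbb K^2$, i.e. with points of $\mathbb P\mathbb K^1$: the line $\ell$ corresponds to the end of the ray with vertices $[(\ell\cap R_0)+p^jR_0]$, $j=0,1,2,\dots$, for any lattice $R_0$. The space $|\mathcal T|\cup\mathbb P\mathbb K^1$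 carries the standard topology of the compactification of a locally finite tree by its ends. *)

(* Defs.v *)
From HB Require Import structures.
From mathcomp Require Import all_boot all_order all_algebra ring_quotient.
From mathcomp Require Import all_classical all_reals all_analysis.
From mathcomp Require Import ring lra zify.

Set Implicit Arguments.
Unset Strict Implicit.
Unset Printing Implicit Defensive.

Import Order.TTheory GRing.Theory Num.Theory.
Import numFieldNormedType.Exports.

Local Open Scope classical_set_scope.
Local Open Scope ring_scope.

Definition padic_val (p : nat) (x : rat) : int :=
  (logn p `|numq x|)%:Z - (logn p `|denq x|)%:Z.

Definition padic_norm (p : nat) (x : rat) : rat :=
  if x == 0 then 0 else p%:R ^ (- padic_val p x).

Section PadicNorm.
Variables (p : nat) (pr_p : prime p).

Let p_gt0 : 0 < p%:R :> rat.
Proof. by rewrite ltr0n prime_gt0. Qed.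

Lemma padic_val_frac (a b : int) : a != 0 -> b != 0 ->
  padic_val p (a%:Q / b%:Q) = (logn p `|a|)%:Z - (logn p `|b|)%:Z.
Proof.
move=> a0 b0; rewrite /padic_val; set x := _ / _.
have aQ0 : a%:Q != 0 by rewrite intr_eq0.
have bQ0 : b%:Q != 0 by rewrite intr_eq0.
have x0 : x != 0 by rewrite mulf_neq0 ?invr_eq0.
have e : numq x * b = a * denq x.
  apply/eqP; rewrite -(eqr_int rat) !intrM numqE /x; apply/eqP.
  by rewrite mulrAC divfK.
have {e} := congr1 (logn p \o absz) e; rewrite /= !abszM.
rewrite !lognM ?absz_gt0 ?numq_eq0 ?denq_eq0//.
lia.
Qed.

Lemma ratP_frac (x : rat) : exists2 a : int * int, a.2 != 0 &
  x = a.1%:Q / a.2%:Q.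
Proof. by exists (numq x, denq x); rewrite ?denq_eq0// divq_num_den. Qed.

Lemma padic_norm0 : padic_norm p 0 = 0.
Proof. by rewrite /padic_norm eqxx. Qed.

Lemma padic_norm_ge0 x : 0 <= padic_norm p x.
Proof. by rewrite /padic_norm; case: ifP => // _; rewrite exprz_ge0// ltW. Qed.

Lemma padic_norm_eq0 x : (padic_norm p x == 0) = (x == 0).
Proof.
rewrite /padic_norm; case: ifPn => [|_]; first by rewrite eqxx.
by rewrite expfz_eq0 (gt_eqF p_gt0) andbF.
Qed.

Lemma padic_norm1 : padic_norm p 1 = 1.
Proof. by rewrite /padic_norm oner_eq0 /padic_val /= logn1 subrr. Qed.

Lemma padic_normN x : padic_norm p (- x) = padic_norm p x.
Proof. by rewrite /padic_norm oppr_eq0 /padic_val numqN denqN abszN. Qed.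

Lemma padic_normM x y : padic_norm p (x * y) = padic_norm p x * padic_norm p y.
Proof.
rewrite /padic_norm mulf_eq0.
have [->|x0] := eqVneq x 0; first by rewrite /= mul0r.
have [->|y0] := eqVneq y 0; first by rewrite orbT mulr0.
rewrite /= -expfzDr ?gt_eqF//; congr (_ ^ _).
move: x0 y0; have [[a b] /= b0 ->] := ratP_frac x.
have [[c d] /= d0 ->] := ratP_frac y.
rewrite !mulf_eq0 !negb_or !intr_eq0 => /andP[a0 _] /andP[c0 _].
have -> : a%:Q / b%:Q * (c%:Q / d%:Q) = (a * c)%:Q / (b * d)%:Q.
  by rewrite !intrM invfM mulrACA.
rewrite !padic_val_frac ?mulf_neq0// !abszM !lognM ?absz_gt0//.
lia.
Qed.

Lemma logn_absD (m n : int) : m + n != 0 -> m != 0 -> n != 0 ->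
  (minn (logn p `|m|) (logn p `|n|) <= logn p `|(m + n)%R|)%N.
Proof.
move=> mn0 m0 n0; rewrite -pfactor_dvdn ?absz_gt0//.
set k := minn _ _.
have dm : (p ^ k %| `|m|)%N by rewrite pfactor_dvdn ?absz_gt0// geq_minl.
have dn : (p ^ k %| `|n|)%N by rewrite pfactor_dvdn ?absz_gt0// geq_minr.
have : (((p ^ k)%N : int) %| m + n)%Z by rewrite rpredD// /dvdz.
by [].
Qed.

Lemma padic_normD x y :
  padic_norm p (x + y) <= Num.max (padic_norm p x) (padic_norm p y).
Proof.
have [->|x0] := eqVneq x 0.
  by rewrite add0r padic_norm0 le_max lexx orbT.
have [->|y0] := eqVneq y 0.
  by rewrite addr0 padic_norm0 le_max lexx.
have [->|xy0] := eqVneq (x + y) 0.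
  by rewrite padic_norm0 le_max padic_norm_ge0.
rewrite /padic_norm (negPf x0) (negPf y0) (negPf xy0).
have p1 : 1 < p%:R :> rat by rewrite ltr1n prime_gt1.
rewrite le_max !ler_eXz2l// !lerN2.
move: x0 y0 xy0; have [[a b] /= b0 ->] := ratP_frac x.
have [[c d] /= d0 ->] := ratP_frac y.
have -> : a%:Q / b%:Q + c%:Q / d%:Q = (a * d + c * b)%:Q / (b * d)%:Q.
  by rewrite intrD !intrM addf_div// intr_eq0.
rewrite !mulf_eq0 !negb_or !invr_eq0 !intr_eq0 => /andP[a0 _] /andP[c0 _].
move=> /andP[ab0 _].
rewrite !padic_val_frac ?mulf_neq0//.
have := logn_absD ab0 (mulf_neq0 a0 d0) (mulf_neq0 c0 b0).
rewrite !abszM !lognM ?absz_gt0//.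
move: (logn p _) (logn p _) (logn p _) (logn p _) (logn p _) => i j k l m.
by rewrite geq_min => /orP[?|?]; apply/orP; [left|right]; lia.
Qed.

Lemma padic_normB_sym x y : padic_norm p (x - y) = padic_norm p (y - x).
Proof. by rewrite -opprB padic_normN. Qed.

Lemma padic_normD_lt x y e : padic_norm p x < e -> padic_norm p y < e ->
  padic_norm p (x + y) < e.
Proof.
by move=> xe ye; rewrite (le_lt_trans (padic_normD x y))// gt_max xe.
Qed.

Lemma padic_normD_eq x y : padic_norm p y < padic_norm p x ->
  padic_norm p (x + y) = padic_norm p x.
Proof.
move=> yx; apply/eqP; rewrite eq_le; apply/andP; split.
  by rewrite (le_trans (padic_normD _ _))// ge_max lexx ltW.
have := padic_normD (x + y) (- y); rewrite addrK padic_normN le_max.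
by rewrite (leNgt _ (padic_norm p y)) yx orbF.
Qed.

End PadicNorm.

Definition padic_cauchy (p : nat) (u : nat -> rat) :=
  forall e : rat, 0 < e -> exists N, forall m n, (N <= m)%N -> (N <= n)%N ->
    padic_norm p (u m - u n) < e.

Definition padic_null (p : nat) (u : nat -> rat) :=
  forall e : rat, 0 < e -> exists N, forall n, (N <= n)%N ->
    padic_norm p (u n) < e.

(* Indexed by the primality proof so that the subring instance below, which
   needs it, can be inferred. *)
Definition is_padic_cauchy (p : nat) (pr_p : prime p) : {pred nat -> rat} :=
  [pred u | `[< padic_cauchy p u >]].

Section CauchySequences.
Variables (p : nat) (pr_p : prime p).

Lemma padic_nullD u v : padic_null p u -> padic_null p v ->
  padic_null p (fun n => u n + v n).
Proof.
move=> u0 v0 e e0; have [[M uM] [N vN]] := (u0 e e0, v0 e e0).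
exists (maxn M N) => n; rewrite geq_max => /andP[Mn Nn].
by rewrite padic_normD_lt ?uM ?vN.
Qed.

Lemma padic_cauchy_bounded u : padic_cauchy p u ->
  exists2 b : rat, 0 < b & forall n, padic_norm p (u n) < b.
Proof.
move=> /(_ 1 ltr01)[N uN].
exists (1 + padic_norm p (u N) + \sum_(i < N) padic_norm p (u i)).
  by rewrite -addrA ltr_wpDr ?ltr01// addr_ge0 ?sumr_ge0// => *;
    rewrite padic_norm_ge0.
move=> n; have [Nn|nN] := leqP N n.
  rewrite -(subrK (u N) (u n)) (le_lt_trans (padic_normD pr_p _ _))// gt_max.
  have s0 : 0 <= \sum_(i < N) padic_norm p (u i).
    by rewrite sumr_ge0// => *; rewrite padic_norm_ge0.
  have := padic_norm_ge0 p (u N); have := uN _ _ Nn (leqnn N).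
  lra.
rewrite (bigD1 (Ordinal nN))//=.
have s0 : 0 <= \sum_(i < N | i != Ordinal nN) padic_norm p (u i).
  by rewrite sumr_ge0// => *; rewrite padic_norm_ge0.
have := padic_norm_ge0 p (u N).
lra.
Qed.

Lemma padic_nullM u v : padic_cauchy p u -> padic_null p v ->
  padic_null p (fun n => u n * v n).
Proof.
move=> /padic_cauchy_bounded[b b0 ub] v0 e e0.
have [N vN] := v0 (e / b) (divr_gt0 e0 b0).
exists N => n Nn; rewrite padic_normM//.
rewrite -[ltRHS](divfK (lt0r_neq0 b0)) [ltRHS]mulrC.
by rewrite ltr_pM ?padic_norm_ge0 ?vN.
Qed.

Lemma padic_cauchy_cst a : padic_cauchy p (fun=> a).
Proof. by move=> e e0; exists 0%N => *; rewrite subrr padic_norm0. Qed.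

Lemma padic_cauchyB u v : padic_cauchy p u -> padic_cauchy p v ->
  padic_cauchy p (fun n => u n - v n).
Proof.
move=> cu cv e e0; have [[M uM] [N vN]] := (cu e e0, cv e e0).
exists (maxn M N) => m n; rewrite !geq_max => /andP[Mm Nm] /andP[Mn Nn].
have -> : u m - v m - (u n - v n) = (u m - u n) + (v n - v m) by ring.
by rewrite padic_normD_lt ?uM ?vN.
Qed.

Lemma padic_cauchyM u v : padic_cauchy p u -> padic_cauchy p v ->
  padic_cauchy p (fun n => u n * v n).
Proof.
move=> cu cv e e0; have [a a0 ua] := padic_cauchy_bounded cu.
have [b b0 vb] := padic_cauchy_bounded cv.
have [M uM] := cu (e / b) (divr_gt0 e0 b0).
have [N vN] := cv (e / a) (divr_gt0 e0 a0).
exists (maxn M N) => m n; rewrite !geq_max => /andP[Mm Nm] /andP[Mn Nn].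
have -> : u m * v m - u n * v n = (u m - u n) * v m + u n * (v m - v n).
  by ring.
apply: padic_normD_lt; rewrite ?padic_normM//.
  rewrite -[ltRHS](divfK (lt0r_neq0 b0)).
  by rewrite ltr_pM ?padic_norm_ge0 ?uM.
rewrite -[ltRHS](divfK (lt0r_neq0 a0)) [ltRHS]mulrC.
by rewrite ltr_pM ?padic_norm_ge0 ?vN.
Qed.

(* A Cauchy sequence that is not null has eventually constant nonzero norm. *)
Lemma padic_cauchy_norm u : padic_cauchy p u -> ~ padic_null p u ->
  exists2 r, 0 < r & exists N, forall n, (N <= n)%N -> padic_norm p (u n) = r.
Proof.
move=> cu /existsNP[e] /not_implyP[e0] /forallNP un0.
have [N uN] := cu e e0.
have /existsNP[m /not_implyP[Nm /negP]] := un0 N.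
rewrite -leNgt => eum.
exists (padic_norm p (u m)); first exact: lt_le_trans eum.
exists N => n Nn; rewrite -(subrK (u m) (u n)) addrC padic_normD_eq//.
exact: lt_le_trans (uN _ _ Nn Nm) eum.
Qed.

Lemma padic_cauchyV u : padic_cauchy p u -> ~ padic_null p u ->
  padic_cauchy p (fun n => (u n)^-1).
Proof.
move=> cu un0; have [r r0 [N uN]] := padic_cauchy_norm cu un0.
move=> e e0; have [M uM] := cu (e * r * r) (mulr_gt0 (mulr_gt0 e0 r0) r0).
exists (maxn M N) => m n; rewrite !geq_max => /andP[Mm Nm] /andP[Mn Nn].
have nz k : (N <= k)%N -> u k != 0.
  by move=> Nk; rewrite -(padic_norm_eq0 pr_p) uN// gt_eqF.
have E : u n - u m = ((u m)^-1 - (u n)^-1) * u m * u n.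
  by field; rewrite !nz.
have := uM n m Mn Mm; rewrite E !padic_normM// !uN//.
by rewrite !ltr_pM2r.
Qed.

Lemma is_padic_cauchy_subring : subring_closed (is_padic_cauchy pr_p).
Proof.
split.
- exact/asboolP/padic_cauchy_cst.
- by move=> u v /asboolP cu /asboolP cv; exact/asboolP/padic_cauchyB.
- by move=> u v /asboolP cu /asboolP cv; exact/asboolP/padic_cauchyM.
Qed.

HB.instance Definition _ :=
  GRing.isSubringClosed.Build (nat -> rat) (is_padic_cauchy pr_p)
    is_padic_cauchy_subring.

End CauchySequences.

(* The ring of p-adic Cauchy sequences of rationals. *)
Record cauchy_seq (p : nat) (pr_p : prime p) := CauchySeq {
  cauchy_fun :> nat -> rat;
  cauchy_funP : cauchy_fun \in is_padic_cauchy pr_p }.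

HB.instance Definition _ p pr_p := [isSub for @cauchy_fun p pr_p].
HB.instance Definition _ p pr_p := [Choice of @cauchy_seq p pr_p by <:].
HB.instance Definition _ p (pr_p : prime p) :=
  [SubChoice_isSubComNzRing of cauchy_seq pr_p by <:].

Definition null_seq (p : nat) (pr_p : prime p) : {pred cauchy_seq pr_p} :=
  [pred u : cauchy_seq pr_p | `[< padic_null p u >]].

Section Padic.
Variables (p : nat) (pr_p : prime p).

Lemma null_seq_idealr : idealr_closed (@null_seq p pr_p).
Proof.
split.
- by apply/asboolP => e e0; exists 0%N => n _; rewrite padic_norm0.
- apply/negP => /asboolP/(_ 1 ltr01)[N /(_ N (leqnn N))].
  by rewrite [X in padic_norm p X]/= padic_norm1 ltxx.
- move=> a u v /asboolP u0 /asboolP v0; apply/asboolP.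
  apply: (padic_nullD pr_p) => //; apply: (padic_nullM pr_p) => //.
  exact/asboolP/cauchy_funP.
Qed.

HB.instance Definition _ :=
  isIdealr.Build (cauchy_seq pr_p) (@null_seq p pr_p) null_seq_idealr.

(* The completion of rat for the p-adic norm: Cauchy sequences modulo null
   sequences. *)
Definition Qp : Type := {ideal_quot (@null_seq p pr_p)}.

HB.instance Definition _ := GRing.ComNzRing.on Qp.

Implicit Types u v : cauchy_seq pr_p.

Definition Qp_of (u : cauchy_seq pr_p) : Qp := \pi_({ideal_quot _})%qT u.

Lemma Qp_ofP (x : Qp) : {u | x = Qp_of u}.
Proof. by exists (repr x); rewrite /Qp_of reprK. Qed.

Lemma Qp_of_eq u v :
  Qp_of u = Qp_of v <-> padic_null p (fun n => u n - v n).
Proof.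
have := Quotient.idealrBE (@null_seq p pr_p) u v => E; split.
  by move=> /eqP; rewrite /Qp_of -E => /asboolP.
by move=> h; apply/eqP; rewrite /Qp_of -E; apply/asboolP.
Qed.

Lemma Qp_ofB u v : Qp_of (u - v) = Qp_of u - Qp_of v.
Proof. exact: (rmorphB (\pi_({ideal_quot (@null_seq p pr_p)})%qT)). Qed.

Lemma Qp_ofM u v : Qp_of (u * v) = Qp_of u * Qp_of v.
Proof. exact: (rmorphM (\pi_({ideal_quot (@null_seq p pr_p)})%qT)). Qed.

Lemma Qp_of1 : Qp_of 1 = 1.
Proof. exact: (rmorph1 (\pi_({ideal_quot (@null_seq p pr_p)})%qT)). Qed.

Lemma Qp_of_eq0 u : Qp_of u = 0 <-> padic_null p u.
Proof.
rewrite -(subrr (Qp_of 0)) -Qp_ofB subrr Qp_of_eq.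
by split=> h e e0; have [N uN] := h e e0; exists N => n /uN /=;
  rewrite subr0.
Qed.

Lemma Qp_inv_subproof (x : Qp) : exists y, if x == 0 then y = 0 else y * x = 1.
Proof.
case: eqVneq => [_|]; first by exists 0.
have [u ->] := Qp_ofP x => /eqP; rewrite Qp_of_eq0 => u0.
have cu := elimT (asboolP _) (cauchy_funP u).
have [r r0 [N uN]] := padic_cauchy_norm pr_p cu u0.
exists (Qp_of (CauchySeq (introT (asboolP _) (padic_cauchyV pr_p cu u0)))).
rewrite -Qp_ofM -Qp_of1; apply/Qp_of_eq => e e0; exists N => n Nn.
rewrite [X in padic_norm p X](_ : _ = (u n)^-1 * u n - 1)// mulVf ?subrr ?padic_norm0//.
by rewrite -(padic_norm_eq0 pr_p) uN// gt_eqF.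
Qed.

Definition Qp_inv (x : Qp) : Qp := sval (cid (Qp_inv_subproof x)).

Lemma Qp_mulVf x : x != 0 -> Qp_inv x * x = 1.
Proof. by rewrite /Qp_inv; case: cid => y /=; case: eqP. Qed.

Lemma Qp_invr0 : Qp_inv 0 = 0.
Proof. by rewrite /Qp_inv; case: cid => y /=; rewrite eqxx. Qed.

HB.instance Definition _ := GRing.ComNzRing_isField.Build Qp Qp_mulVf Qp_invr0.

(* The values |u n| have a limit in rat: they tend to 0 or are eventually
   constant. *)
Definition Qp_norm (x : Qp) : rat :=
  limn (fun n => padic_norm p (repr x n) : rat^o).

Lemma Qp_norm_spec u :
  (padic_null p u /\ Qp_norm (Qp_of u) = 0) \/
  (0 < Qp_norm (Qp_of u) /\
    exists N, forall n, (N <= n)%N -> padic_norm p (u n) = Qp_norm (Qp_of u)).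
Proof.
set v := repr (Qp_of u).
have uv : padic_null p (fun n => u n - v n).
  by apply/Qp_of_eq; rewrite {2}/Qp_of /v reprK.
have -> : Qp_norm (Qp_of u) = limn (fun n => padic_norm p (v n) : rat^o) by [].
have [u0|u0] := pselect (padic_null p u).
  left; split=> //; apply: (@cvg_lim rat^o); first exact: norm_hausdorff.
  apply/(@cvgrPdist_lt _ rat^o) => e e0.
  have [[M uM] [N vN]] := (u0 e e0, uv e e0).
  exists (maxn M N) => // n /=; rewrite geq_max => /andP[Mn Nn].
  rewrite sub0r normrN ger0_norm ?padic_norm_ge0//.
  rewrite -(subKr (u n) (v n)) padic_normD_lt ?uM//.
  by rewrite padic_normN// vN.
right.
have cu := elimT (asboolP _) (cauchy_funP u).
have [r r0 [N uN]] := padic_cauchy_norm pr_p cu u0.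
have [M uM] := uv r r0.
have -> : limn (fun n => padic_norm p (v n) : rat^o) = r.
  apply: (@cvg_lim rat^o); first exact: norm_hausdorff.
  apply: cvg_near_cst; exists (maxn M N) => // n /=.
  rewrite geq_max => /andP[Mn Nn].
  rewrite -(subKr (u n) (v n)) padic_normD_eq ?uN//.
  by rewrite padic_normN// uM.
by split=> //; exists N.
Qed.

Lemma Qp_norm_ge0 x : 0 <= Qp_norm x.
Proof.
by have [u ->] := Qp_ofP x; case: (Qp_norm_spec u) => [[_ ->]|[/ltW]].
Qed.

Lemma Qp_norm_eq0 x : (Qp_norm x == 0) = (x == 0).
Proof.
have [u ->] := Qp_ofP x; case: (Qp_norm_spec u) => [[u0 ->]|[r0 [N uN]]].
  by rewrite eqxx; apply/esym/eqP/Qp_of_eq0.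
rewrite gt_eqF//; apply/esym/negbTE/eqP => /Qp_of_eq0/(_ _ r0)[M uM].
have := uM (maxn M N) (leq_maxl _ _).
by rewrite uN ?leq_maxr// ltxx.
Qed.

Lemma Qp_norm_near u (e : rat) : 0 < e -> exists N, forall n, (N <= n)%N ->
  `|Qp_norm (Qp_of u) - padic_norm p (u n)| < e.
Proof.
move=> e0; case: (Qp_norm_spec u) => [[u0 ->]|[_ [N uN]]].
  have [N uN] := u0 e e0; exists N => n /uN.
  by rewrite sub0r normrN ger0_norm ?padic_norm_ge0.
by exists N => n /uN ->; rewrite subrr normr0.
Qed.

Lemma Qp_normM x y : Qp_norm (x * y) = Qp_norm x * Qp_norm y.
Proof.
have [u ->] := Qp_ofP x; have [v ->] := Qp_ofP y.
have [[u0 E]|[r0 [N uN]]] := Qp_norm_spec u.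
  by move/Qp_of_eq0: u0 => u0; rewrite E u0 !mul0r -u0.
have [[v0 E]|[s0 [M vM]]] := Qp_norm_spec v.
  by move/Qp_of_eq0: v0 => v0; rewrite E v0 !mulr0 -v0.
rewrite -Qp_ofM; case: (Qp_norm_spec (u * v)) => [[uv0 _]|[_ [L uvL]]].
  have [L uvL] := uv0 _ (mulr_gt0 r0 s0).
  have := uvL (maxn L (maxn M N)) (leq_maxl _ _).
  by rewrite padic_normM// uN ?vM ?ltxx ?leq_max ?leqnn ?orbT.
rewrite -(uvL (maxn L (maxn M N))) ?leq_maxl//.
by rewrite padic_normM// uN ?vM ?leq_max ?leqnn ?orbT.
Qed.

Lemma Qp_norm1 : Qp_norm 1 = 1.
Proof.
have : Qp_norm 1 * Qp_norm 1 = Qp_norm 1 by rewrite -Qp_normM mulr1.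
by move/(canRL (mulfK _)) => -> //; rewrite ?divff// Qp_norm_eq0 oner_eq0.
Qed.

Lemma Qp_norm0 : Qp_norm 0 = 0.
Proof. by apply/eqP; rewrite Qp_norm_eq0. Qed.

Lemma Qp_normN x : Qp_norm (- x) = Qp_norm x.
Proof.
rewrite -mulN1r Qp_normM; have /eqP : Qp_norm (- 1) ^+ 2 = 1.
  by rewrite expr2 -Qp_normM mulrNN mulr1 Qp_norm1.
rewrite sqrf_eq1 => /orP[/eqP ->|/eqP E]; first by rewrite mul1r.
by have := Qp_norm_ge0 (-1); rewrite E ler0N1.
Qed.

Lemma Qp_normD x y : Qp_norm (x + y) <= Num.max (Qp_norm x) (Qp_norm y).
Proof.
have [u ->] := Qp_ofP x; have [v0 E] := Qp_ofP (- y).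
have -> : y = - Qp_of v0 by rewrite -E opprK.
rewrite Qp_normN -Qp_ofB leNgt; apply/negP.
move Ea : (Num.max _ _) => a lt_a.
have e0 : 0 < (Qp_norm (Qp_of (u - v0)) - a) / 2 by rewrite divr_gt0 ?subr_gt0.
have [[L uL] [M vM]] := (Qp_norm_near u e0, Qp_norm_near v0 e0).
have [N uvN] := Qp_norm_near (u - v0) e0.
pose n := maxn L (maxn M N).
have [Ln Mn Nn] : [/\ (L <= n)%N, (M <= n)%N & (N <= n)%N].
  by rewrite !leq_max !leqnn !orbT.
have := uL n Ln; have := vM n Mn; have := uvN n Nn.
have -> : (u - v0) n = u n - v0 n by [].
have := padic_normD pr_p (u n) (- v0 n); rewrite padic_normN//.
have : Qp_norm (Qp_of u) <= a by rewrite -Ea le_max lexx.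
have : Qp_norm (Qp_of v0) <= a by rewrite -Ea le_max lexx orbT.
move=> h1 h2; rewrite le_max !ltr_norml => /orP[] h3 /andP[h4 h5] /andP[h6 h7].
all: move=> /andP[h8 h9]; clear E; move: h1 h2 h3 h4 h5 h6 h7 h8 h9.
all: move: (Qp_norm (Qp_of (u - v0))) (Qp_norm (Qp_of u)) (Qp_norm (Qp_of v0))
  (padic_norm p (u n - v0 n)) (padic_norm p (u n)) (padic_norm p (v0 n)).
all: by move=> *; lra.
Qed.

Lemma Qp_norm_nat (n : nat) : Qp_norm n%:R = padic_norm p n%:R.
Proof.
have -> : n%:R = Qp_of n%:R.
  exact: esym (rmorph_nat (\pi_({ideal_quot (@null_seq p pr_p)})%qT) n).
have nE k : (n%:R : cauchy_seq pr_p) k = n%:R.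
  by elim: n => // n IH; rewrite !mulrS -IH.
case: (Qp_norm_spec n%:R) => [[n0 ->]|[_ [N /(_ N (leqnn N))]]].
  apply/esym/eqP; rewrite eq_le padic_norm_ge0 andbT leNgt; apply/negP.
  by move=> /n0[N /(_ N (leqnn N))]; rewrite nE ltxx.
by rewrite nE.
Qed.

Definition Qp_ball (x : Qp) (e : rat) (y : Qp) := Qp_norm (x - y) < e.

HB.instance Definition _ := hasNbhs.Build Qp (nbhs_ball_ Qp_ball).

Lemma Qp_ball_center x (e : rat) : 0 < e -> Qp_ball x e x.
Proof.
by move=> e0; rewrite /Qp_ball subrr Qp_norm0.
Qed.

Lemma Qp_ball_sym x y (e : rat) : Qp_ball x e y -> Qp_ball y e x.
Proof. by rewrite /Qp_ball -opprB Qp_normN. Qed.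

Lemma Qp_ball_triangle x y z (e1 e2 : rat) :
  Qp_ball x e1 y -> Qp_ball y e2 z -> Qp_ball x (e1 + e2) z.
Proof.
rewrite /Qp_ball => xy yz; have -> : x - z = (x - y) + (y - z) by ring.
rewrite (le_lt_trans (Qp_normD _ _))// gt_max.
have := Qp_norm_ge0 (x - y); have := Qp_norm_ge0 (y - z).
by move: (Qp_norm _) (Qp_norm _) xy yz => a b; lra.
Qed.

Let Qp_nbhsE : nbhs = nbhs_ (entourage_ Qp_ball).
Proof.
rewrite /nbhs_ entourage_E predeq2E => x A; split.
  move=> [e e0 sbeA]; exists [set xy | Qp_ball xy.1 e xy.2]; first by exists e.
  by move=> r /xsectionP; exact: sbeA.
by move=> [E [e e0 sbeE] sEA]; exists e => // ? ?; exact/sEA/xsectionP/sbeE.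
Qed.

HB.instance Definition _ := Nbhs_isPseudoMetric.Build rat Qp
  Qp_nbhsE Qp_ball_center Qp_ball_sym Qp_ball_triangle erefl.

End Padic.

Section Lattices.
Variables (p : nat) (pr_p : prime p).
Local Notation K := (Qp pr_p).
Local Notation V := 'rV[K]_2.

Definition Zp : set K := [set a | Qp_norm a <= 1].

Definition submodule (L : set V) :=
  [/\ L 0, forall u v, L u -> L v -> L (u + v) &
      forall a v, Zp a -> L v -> L (a *: v)].

Definition lattice (L : set V) :=
  [/\ compact L, submodule L & forall v, exists a, exists2 w, L w & v = a *: w].

Definition dilate (a : K) (L : set V) : set V := [set a *: v | v in L].

Definition std_lattice : set V := [set v | forall i, Zp (v 0 i)].

(* A vertex of the Bruhat-Tits tree is an equivalence class of lattices. *)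
Record vertex := Vertex {
  vclass : set (set V);
  vclassP : exists2 L, lattice L &
    vclass = [set dilate a L | a in [set a | a != 0]] }.

Definition adj (v w : vertex) :=
  v <> w /\ exists L M a, [/\ vclass v L, vclass w M, a != 0 &
    dilate p%:R M `<=` dilate a L /\ dilate a L `<=` M].

Record projline := ProjLine {
  line : {vspace V};
  dim_line : \dim line = 1%N }.

Definition ray_lattice (L0 : set V) (l : projline) (j : nat) : set V :=
  [set v + p%:R ^+ j *: w | v in [set` line l] `&` L0 & w in L0].

(* Value at (x, y) of the degree d homogenization of a. *)
Definition homog_eval (d : nat) (a : {poly K}) (x y : K) : K :=
  \sum_(i < d.+1) a`_i * x ^+ i * y ^+ (d - i).

(* The line spanned by (x, y) is the point t = x / y of the projective line;
   f is t |-> a(t) / b(t), in homogeneous coordinates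
   [x : y] |-> [a(x, y) : b(x, y)]. *)
Definition rational_map (f : projline -> projline) :=
  exists a b : {poly K}, coprimep a b /\
    let d := (maxn (size a) (size b)).-1 in
    forall l (v : V), v \in line l -> v != 0 ->
      let x := v 0 0 in let y := v 0 1 in
      let w : V := \row_(j < 2)
        (if j == 0 then homog_eval d a x y else homog_eval d b x y) in
      line (f l) = <[w]>%VS.

End Lattices.

Section Realization.
Variables (R : realType) (p : nat) (pr_p : prime p).
Local Notation vertex := (vertex pr_p).

(* Barycentric coordinates of the point at parameter t of the segment from
   v to w. *)
Definition segment (v w : vertex) (t : R) : vertex -> R :=
  fun x => (1 - t) * \1_[set v] x + t * \1_[set w] x.

Record realization := Realization {
  bary : vertex -> R;
  baryP : exists v w t,
    [/\ v = w \/ adj v w, 0 <= t <= 1 & bary = segment v w t] }.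

Lemma bary_inj : injective bary.
Proof.
by move=> [a aP] [b bP] /= ab; move: aP bP; rewrite ab => aP bP;
  congr Realization; exact: Prop_irrelevance.
Qed.

Lemma vertex_pt_subproof (v : vertex) : exists u w t,
  [/\ u = w \/ adj u w, 0 <= t <= 1 & \1_[set v] = segment u w t :> (_ -> R)].
Proof.
exists v, v, 0; split; [by left|by rewrite lexx ler01|].
by apply/funext => x; rewrite /segment subr0 mul1r mul0r addr0.
Qed.

Definition vertex_pt (v : vertex) : realization :=
  Realization (vertex_pt_subproof v).

Definition edge (v w : vertex) : set realization :=
  [set x | exists2 t, 0 <= t <= 1 & bary x = segment v w t].

HB.instance Definition _ := gen_eqMixin realization.
HB.instance Definition _ := gen_choiceMixin realization.

(* The weak topology: a set is open iff its trace on each closed edge is. *)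
Definition weak_open (A : set realization) := forall v w : vertex, adj v w ->
  @open (subspace (`[0, 1]%classic : set R))
    [set t : R | exists2 x, A x & bary x = segment v w t].

Lemma weak_openT : weak_open setT.
Proof.
move=> v w vw; rewrite -open_subspaceIT.
rewrite (_ : _ `&` _ = `[0, 1]%classic); first exact: open_subspaceT.
apply/seteqP; split=> [t []//|t t01]; split => //=.
have tP : exists v' w' t', [/\ v' = w' \/ adj v' w', 0 <= t' <= 1 &
    segment v w t = segment v' w' t'].
  by exists v, w, t; split=> //; right.
by exists (Realization tP).
Qed.

Lemma weak_openI : setI_closed weak_open.
Proof.
move=> A B oA oB v w vw; have := openI (oA v w vw) (oB v w vw).
congr open; apply/seteqP; split=> [t [[x Ax xE] [y By yE]]|t [x [Ax Bx] xE]].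
  exists x => //; split=> //.
  by rewrite (_ : x = y)//; apply: bary_inj; rewrite xE yE.
by split; exists x.
Qed.

Lemma weak_open_bigU (I : Type) (A : I -> set realization) :
  (forall i, weak_open (A i)) -> weak_open (\bigcup_i A i).
Proof.
move=> oA v w vw.
have : @open (subspace (`[0, 1]%classic : set R)) (\bigcup_i
    [set t : R | exists2 x, A i x & bary x = segment v w t]).
  by apply: bigcup_open => i _; exact: oA.
congr open; apply/seteqP; split=> [t [i _ [x Ax xE]]|t [x [i _ Ax] xE]].
  by exists x => //; exists i.
by exists i => //; exists x.
Qed.

HB.instance Definition _ := isOpenTopological.Build realization
  weak_openT weak_openI weak_open_bigU.

(* The ray that represents the end l eventually stays in U. *)
Definition end_in (l : projline pr_p) (U : set realization) :=
  \forall j \near \oo,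
    exists2 v, vclass v (ray_lattice (@std_lattice _ pr_p) l j) &
      U (vertex_pt v).

Inductive compactification :=
  | Inner of realization
  | End of projline pr_p.

HB.instance Definition _ := gen_eqMixin compactification.
HB.instance Definition _ := gen_choiceMixin compactification.

Definition with_ends (U : set realization) : set compactification :=
  [set z | match z with Inner x => U x | End l => end_in l U end].

(* The end compactification: its topology is generated by the open subsets of
   the tree and by the components of complements of compact subsets of the
   tree, each together with the ends that lie in it. *)
Definition end_subbase : set (set compactification) :=
  [set Inner @` A | A in [set A | open A]] `|`
  [set W | exists C x, [/\ compact C, ~ C x &
    W = with_ends (connected_component (~` C) x)]].

HB.instance Definition _ :=
  isSubBaseTopological.Build compactification end_subbase id.

End Realization.

Arguments Inner {R p pr_p}.
Arguments End {R p pr_p}.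

(* Main.v *)
(** Write a vertex as the j-th vertex of the ray from the standard lattice to a
    line l: it only depends on l modulo p^j, and edges join consecutive
    vertices of such rays. By compactness of the primitive vectors a rational
    map f is Lipschitz: if l and l' agree modulo p^(c+j), then f l and f l'
    agree modulo p^j. Hence sending the vertex (l, j) to (f l, max(j - c, 0)) is
    well defined; its affine extension maps the branch of l modulo p^(c+j)
    into the branch of f l modulo p^j, which gives continuity at the ends. *)

From HB Require Import structures.
Require Import Defs.
From mathcomp Require Import finmap.
From mathcomp Require Import all_boot all_order all_algebra.
From mathcomp Require Import all_classical all_reals all_analysis.
From mathcomp Require Import ring lra zify.

Set Implicit Arguments.
Unset Strict Implicit.
Unset Printing Implicit Defensive.

Import Order.TTheory GRing.Theory Num.Theory.
Import numFieldNormedType.Exports.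

Local Open Scope classical_set_scope.
Local Open Scope ring_scope.

#[local] Opaque Qp_norm.

(** * Norm and compactness of the p-adic integers *)

Section PadicNumbers.
Variables (p : nat) (pr_p : prime p).
Local Notation K := (Qp pr_p).
Local Notation O := (@Defs.Zp p pr_p).
Local Notation q := (p%:R^-1 : rat).
Implicit Types (x y : K) (n k : nat).

(** The shift c is forced by the possible expansion of f: knowing l modulo p^j determines f l only
    to a lower precision. It combines two exponents. One clears the denominators of the coefficients
    of f, which makes the homogeneous lift of f to vectors Lipschitz. The other bounds the lift from
    below on primitive vectors, because a short image vector must be rescaled to generate f l
    primitively; the lift is nowhere zero there since its values span lines. One more unit keeps the
    lines congruent modulo p, so that their generators can be matched. Truncation at 0 collapses the
    ball of radius c around the standard vertex, which is where edges may become vertices.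

    All of this is expressed through the determinant. With q = 1/p, the lattice Zp e + p^j Zp^2 of a
    primitive e consists of the v with |v| <= 1 and |det(e, v)| <= q^j, and two lines agree modulo
    p^j when the determinant of their primitive generators has norm at most q^j. Equality and
    adjacency of vertices thus become norm inequalities. *)

Let p_gt0 : 0 < p%:R :> rat.
Proof. by rewrite ltr0n prime_gt0. Qed.

Lemma q_gt0 : 0 < q.
Proof. by rewrite invr_gt0. Qed.

Lemma q_ge0 : 0 <= q.
Proof. exact: ltW q_gt0. Qed.

Lemma q_lt1 : q < 1.
Proof. by rewrite invf_lt1// ltr1n prime_gt1. Qed.

Lemma qX_gt0 n : 0 < q ^+ n.
Proof. by rewrite exprn_gt0// q_gt0. Qed.

Lemma qX_le1 n : q ^+ n <= 1.
Proof. by rewrite exprn_ile1 ?q_ge0// ltW// q_lt1. Qed.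

Lemma ler_qX m n : (q ^+ m <= q ^+ n) = (n <= m)%N.
Proof. by rewrite ler_iXn2l ?q_gt0 ?q_lt1. Qed.

Lemma ltr_qX m n : (q ^+ m < q ^+ n) = (n < m)%N.
Proof. by rewrite ltr_iXn2l ?q_gt0 ?q_lt1. Qed.

Lemma qX_small (e : rat) : 0 < e -> exists n, q ^+ n < e.
Proof.
move=> e0; exists (Num.bound e^-1); rewrite exprVn invf_plt ?posrE ?exprn_gt0//.
apply: lt_trans (archi_boundP _) _; first by rewrite invr_ge0 ltW.
by rewrite -natrX ltr_nat ltn_expl// prime_gt1.
Qed.

Lemma ler_qXz (k l : int) : (q ^ k <= q ^ l) = (l <= k).
Proof. by rewrite !exprz_inv ler_eXz2l ?ltr1n ?prime_gt1// lerN2. Qed.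

Lemma ltr_qXz (k l : int) : (q ^ k < q ^ l) = (l < k).
Proof. by rewrite !ltNge ler_qXz. Qed.

Lemma Qp_norm_val x : x != 0 -> exists k : int, Qp_norm x = q ^ k.
Proof.
have [u ->] := Qp_ofP x => /eqP x0.
have [[/Qp_of_eq0//]|[r0 [N /(_ N (leqnn N)) E]]] := Qp_norm_spec u.
move: r0; rewrite -E /padic_norm; case: ifP => [_|_ _]; first by rewrite ltxx.
by exists (padic_val p (u N)); rewrite exprz_inv.
Qed.

Lemma Qp_norm_p : Qp_norm (p%:R : K) = q.
Proof.
rewrite Qp_norm_nat /padic_norm pnatr_eq0 -leqn0 leqNgt prime_gt0//=.
rewrite /padic_val -[p%:R]/(p%:Z%:~R) numq_int denq_int/= logn1 subr0.
by rewrite logn_prime// eqxx.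
Qed.

Lemma Qp_normX x n : Qp_norm (x ^+ n) = Qp_norm x ^+ n.
Proof.
by elim: n => [|n IH]; rewrite ?expr0 ?Qp_norm1// !exprS Qp_normM IH.
Qed.

Lemma Qp_norm_pX n : Qp_norm (p%:R ^+ n : K) = q ^+ n.
Proof. by rewrite Qp_normX Qp_norm_p. Qed.

Lemma Qp_pX_neq0 n : p%:R ^+ n != 0 :> K.
Proof. by rewrite -Qp_norm_eq0 Qp_norm_pX gt_eqF// qX_gt0. Qed.

Lemma Qp_norm_gt0 x : (0 < Qp_norm x) = (x != 0).
Proof. by rewrite lt_def Qp_norm_ge0 andbT Qp_norm_eq0. Qed.

Lemma Qp_normV x : Qp_norm x^-1 = (Qp_norm x)^-1.
Proof.
have [->|x0] := eqVneq x 0; first by rewrite invr0 Qp_norm0 invr0.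
have n0 : Qp_norm x != 0 by rewrite Qp_norm_eq0.
by apply: (mulfI n0); rewrite -Qp_normM !divff// Qp_norm1.
Qed.

Lemma Qp_normD_le x y (r : rat) :
  Qp_norm x <= r -> Qp_norm y <= r -> Qp_norm (x + y) <= r.
Proof. by move=> xr yr; rewrite (le_trans (Qp_normD _ _))// ge_max xr. Qed.

Lemma Qp_normB_le x y (r : rat) :
  Qp_norm x <= r -> Qp_norm y <= r -> Qp_norm (x - y) <= r.
Proof. by move=> xr yr; rewrite Qp_normD_le// Qp_normN. Qed.

Lemma Qp_normBC x y : Qp_norm (x - y) = Qp_norm (y - x).
Proof. by rewrite -opprB Qp_normN. Qed.

(** The value group is discrete, generated by q. *)
Lemma Qp_norm_lt1 x : Qp_norm x < 1 -> Qp_norm x <= q.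
Proof.
have [->|/Qp_norm_val[k ->]] := eqVneq x 0; first by rewrite Qp_norm0 q_ge0.
rewrite -[X in _ < X](expr0z q) -[X in _ <= X]expr1z.
by rewrite ltr_qXz ler_qXz; lia.
Qed.

Lemma Qp_norm_qX x : x != 0 -> Qp_norm x <= 1 -> exists n, Qp_norm x = q ^+ n.
Proof.
move=> /Qp_norm_val[k ->]; rewrite -[X in _ <= X](expr0z q).
rewrite ler_qXz.
by case: k => // n _; exists n.
Qed.

Lemma Qp_norm_of_le (u : cauchy_seq pr_p) (r : rat) :
  (exists N, forall n, (N <= n)%N -> padic_norm p (u n) <= r) ->
  Qp_norm (Qp_of u) <= r.
Proof.
move=> [N uN]; have [[_ ->]|[_ [M uM]]] := Qp_norm_spec u.
  exact: le_trans (padic_norm_ge0 _ _) (uN N (leqnn N)).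
by rewrite -(uM (maxn M N)) ?leq_maxl// uN// leq_maxr.
Qed.

Lemma padic_norm_int n (z : int) :
  (((p ^ n)%N : int) %| z)%Z -> padic_norm p z%:~R <= q ^+ n.
Proof.
have [->|z0] := eqVneq z 0; first by rewrite padic_norm0 ltW ?qX_gt0.
rewrite dvdzE /= pfactor_dvdn ?absz_gt0// => nz.
rewrite /padic_norm intr_eq0 (negPf z0) /padic_val numq_int denq_int /= logn1.
by rewrite subr0 -exprz_inv -[X in X <= _]/(q ^+ _) ler_qX.
Qed.

(** The denominator is prime to p, so a Bezout relation inverts it modulo p^n; k is the numerator
    times this inverse, reduced modulo p^n. *)
Lemma rat_digits (r : rat) n : padic_norm p r <= 1 ->
  exists2 k, (k < p ^ n)%N & padic_norm p (r - k%:R) <= q ^+ n.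
Proof.
have [->|r0] := eqVneq r 0.
  exists 0%N; rewrite ?expn_gt0 ?prime_gt0// subr0 padic_norm0.
  exact: ltW (qX_gt0 n).
have pd : ~~ (p %| `|denq r|)%N -> padic_norm p (denq r)%:~R = 1.
  move=> pd; rewrite /padic_norm intr_eq0 denq_eq0.
  rewrite /padic_val numq_int denq_int/= logn1.
  by rewrite (lognE p `|denq r|) (negPf pd) !andbF.
rewrite {1}/padic_norm (negPf r0) -exprz_inv -[X in _ <= X](expr0z q).
rewrite ler_qXz /padic_val => vr.
have {}pd : padic_norm p (denq r)%:~R = 1 /\ coprime (p ^ n) `|denq r|.
  have [d|d] := boolP (p %| `|denq r|)%N; last first.
    by split; [exact: pd|rewrite coprimeXl// prime_coprime].
  have : (0 < logn p `|denq r|)%N by rewrite logn_gt0 mem_primes pr_p d absz_gt0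
    denq_eq0.
  (* If p divided the denominator, integrality would make it divide the numerator too, against
     coprimality. *)
  move=> d1; have : (0 < logn p `|numq r|)%N by lia.
  rewrite logn_gt0 mem_primes => /and3P[_ _ nd].
  have := coprime_num_den r; rewrite /coprime => /eqP g.
  have : (p %| gcdn `|numq r| `|denq r|)%N by rewrite dvdn_gcd nd d.
  by rewrite g dvdn1 => /eqP p1; have := prime_gt1 pr_p; rewrite p1.
case: pd => pd /eqP; rewrite gcdnC.
have d0 : (0 < `|denq r|)%N by rewrite absz_gt0 denq_eq0.
have [a b ab _] := egcdnP (p ^ n) d0 => g; rewrite g in ab.
pose k := ((numq r * a%:Z) %% (p ^ n)%:Z)%Z.
have pn0 : (p ^ n)%:Z != 0 by rewrite -lt0n expn_gt0 prime_gt0.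
have k0 : 0 <= k by apply: modz_ge0.
have dE : denq r = `|denq r|%N by rewrite absz_denq.
exists `|k|%N.
  by rewrite -ltz_nat gez0_abs// ltz_pmod// lt_def pn0.
have -> : (`|k|%N)%:R = k%:~R :> rat by rewrite -[in RHS](gez0_abs k0).
have : (((p ^ n)%N : int) %| numq r - k * denq r)%Z.
  have -> : numq r - k * denq r = - (b%:Z * (p ^ n)%:Z) * numq r +
     ((numq r * a%:Z %/ (p ^ n)%:Z)%Z * (p ^ n)%:Z) * denq r.
    have {1}-> : numq r = numq r * ((a * `|denq r|)%N%:Z - (b * p ^ n)%N%:Z).
      by rewrite ab PoszD addrAC subrr add0r mulr1.
    rewrite !PoszM -dE /k.
    have := divz_eq (numq r * a) (p ^ n)%:Z.
    move: (_ %/ _)%Z (_ %% _)%Z => s t E; rewrite mulrBr mulrA E; ring.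
  by apply: rpredD; rewrite ?mulNr ?rpredN mulrAC dvdz_mull.
move=> /padic_norm_int; rewrite intrB intrM numqE -mulrBl padic_normM// pd.
by rewrite mulr1.
Qed.

(** A late term of a rational Cauchy sequence for x is integral and within q^n of x, which reduces
    the claim to [rat_digits]. *)
Lemma Zp_digits x n : O x ->
  exists2 k, (k < p ^ n)%N & Qp_norm (x - k%:R) <= q ^+ n.
Proof.
have [u ->] := Qp_ofP x => xZ.
have [N uN] : exists N, forall m, (N <= m)%N -> padic_norm p (u m) <= 1.
  have [[u0 _]|[_ [N uN]]] := Qp_norm_spec u.
    by have [N uN] := u0 1 ltr01; exists N => m /uN/ltW.
  by exists N => m /uN ->.
have cu := elimT (asboolP _) (cauchy_funP u).
have [M uM] := cu _ (qX_gt0 n).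
have [k kp uk] := rat_digits n (uN _ (leq_maxl N M)).
exists k => //; have -> : k%:R = Qp_of (k%:R : cauchy_seq pr_p).
  exact: esym (rmorph_nat (\pi_({ideal_quot (@null_seq p pr_p)})%qT) k).
have kE i : (k%:R : cauchy_seq pr_p) i = k%:R.
  by elim: (k) => // j IH; rewrite !mulrS -IH.
rewrite -Qp_ofB; apply: Qp_norm_of_le; exists M => m Mm.
rewrite [X in padic_norm p X](_ : _ = u m - k%:R); last by rewrite -(kE m).
rewrite -(subrK (u (maxn N M)) (u m)) -addrA.
rewrite (le_trans (padic_normD pr_p _ _))// ge_max uk andbT ltW//.
by rewrite uM// leq_maxr.
Qed.

Lemma Qp_norm_natB (m n : nat) :
  Qp_norm (m%:R - n%:R : K) = padic_norm p (m%:R - n%:R).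
Proof.
have [mn|/ltnW mn] := leqP n m; first by rewrite -!natrB// Qp_norm_nat.
by rewrite Qp_normBC padic_normB_sym// -!natrB// Qp_norm_nat.
Qed.

(** For each n, finitely many balls of radius q^n cover Zp, so an ultrafilter on Zp contains one of
    them. Any two chosen balls meet, hence their integer centres form a Cauchy sequence, and its
    limit is the limit of the ultrafilter. *)
Lemma Zp_compact : compact O.
Proof.
rewrite compact_ultra => F FU FZ.
have /choice[k kF] n : exists k : nat,
  F [set x : K | Qp_norm (x - k%:R) <= q ^+ n].
  apply: contrapT => /forallNP nF.
  have /(filterI FZ)/filter_ex[x [/(Zp_digits n)[i ip xi]]] :
    F [set x | forall i : 'I_(p ^ n), ~ Qp_norm (x - i%:R) <= q ^+ n].
    apply: filter_forall => i.
    by have [/nF|] := in_ultra_setVsetC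
      [set x : K | Qp_norm (x - i%:R) <= q ^+ n] FU.
  by move=> /(_ (Ordinal ip)).
have kk m n : (m <= n)%N -> padic_norm p ((k n)%:R - (k m)%:R) <= q ^+ m.
  move=> mn; rewrite -Qp_norm_natB.
  have [x [/= xn xm]] := filter_ex (filterI (kF n) (kF m)).
  rewrite -(subrKA x) Qp_normD_le// Qp_normBC (le_trans xn)// ler_qX//.
have ck : padic_cauchy p (fun n => (k n)%:R).
  move=> e /qX_small[N Ne]; exists N => m n Nm Nn; apply: le_lt_trans Ne.
  rewrite -(subrKA (k N)%:R) (le_trans (padic_normD pr_p _ _))// ge_max kk//.
  by rewrite padic_normB_sym// kk.
pose x := Qp_of (CauchySeq (introT (asboolP _) ck) : cauchy_seq pr_p).
have xk n : Qp_norm (x - (k n)%:R) <= q ^+ n.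
  have -> : (k n)%:R = Qp_of ((k n)%:R : cauchy_seq pr_p).
    exact: esym (rmorph_nat (\pi_({ideal_quot (@null_seq p pr_p)})%qT) _).
  have kE i : ((k n)%:R : cauchy_seq pr_p) i = (k n)%:R.
    by elim: (k n) => // j IH; rewrite !mulrS -IH.
  rewrite -Qp_ofB; apply: Qp_norm_of_le; exists n => m nm.
  by rewrite [X in padic_norm p X](_ : _ = (k m)%:R - (k n)%:R) ?kk// -(kE m).
exists x; split.
  have := xk 0%N; rewrite expr0 => x0.
  rewrite /Defs.Zp/= -(subrK (k 0%N)%:R x) Qp_normD_le//.
  have [y [yZ /= yk]] := filter_ex (filterI FZ (kF 0%N)).
  by rewrite -(subKr y (k 0%N)%:R) Qp_normB_le.
move=> A /nbhs_ballP[e /= /qX_small[n ne] xA].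
apply: filterS (kF n) => y /= yk; apply: xA; apply: le_lt_trans ne.
by rewrite -(subrKA (k n)%:R) Qp_normD_le// Qp_normBC.
Qed.

End PadicNumbers.

(** * Lattices in the plane *)

Section Wedge.
Variable F : fieldType.
Implicit Types (a : F) (u v w e c : 'rV[F]_2).

Definition wedge u v : F := u 0 0 * v 0 1 - u 0 1 * v 0 0.

Lemma ord2P (i : 'I_2) : i = 0 \/ i = 1.
Proof. by case: i => -[|[|//]] i; [left|right]; exact/val_inj. Qed.

Lemma rV2P u v : u 0 0 = v 0 0 -> u 0 1 = v 0 1 -> u = v.
Proof.
move=> e0 e1; by apply/rowP => i; case: (ord2P i) => ->.
Qed.

Lemma wedgeC u v : wedge u v = - wedge v u.
Proof. by rewrite /wedge; ring. Qed.

Lemma wedgevv u : wedge u u = 0.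
Proof. by rewrite /wedge; ring. Qed.

Lemma wedgeDr u v w : wedge u (v + w) = wedge u v + wedge u w.
Proof. by rewrite /wedge !mxE; ring. Qed.

Lemma wedgeZr a u v : wedge u (a *: v) = a * wedge u v.
Proof. by rewrite /wedge !mxE; ring. Qed.

Lemma wedgeDl u v w : wedge (v + w) u = wedge v u + wedge w u.
Proof. by rewrite /wedge !mxE; ring. Qed.

Lemma wedgeZl a u v : wedge (a *: u) v = a * wedge u v.
Proof. by rewrite /wedge !mxE; ring. Qed.

(** Cramer's rule in the basis (e, c). *)
Lemma wedge_decomp e c v : wedge e c = 1 ->
  v = wedge v c *: e + wedge e v *: c.
Proof.
rewrite /wedge => h; apply: rV2P; rewrite !mxE.
  by rewrite -[LHS]mulr1 -h; ring.
by rewrite -[LHS]mulr1 -h; ring.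
Qed.

Lemma wedge_coords e c (x y : F) : wedge e c = 1 ->
  wedge e (x *: e + y *: c) = y.
Proof. by move=> h; rewrite wedgeDr !wedgeZr wedgevv h mulr0 add0r mulr1. Qed.

End Wedge.

Lemma ex_min_nat (P : nat -> Prop) : (exists n, P n) ->
  exists2 n, P n & forall m, P m -> (n <= m)%N.
Proof.
move=> [n Pn]; have ex : exists n, `[< P n >] by exists n; exact/asboolP.
exists (ex_minn ex); first by case: ex_minnP => m /asboolP.
by move=> m Pm; case: ex_minnP => k _; apply; exact/asboolP.
Qed.

Section Plane.
Variables (p : nat) (pr_p : prime p).
Local Notation K := (Qp pr_p).
Local Notation O := (@Defs.Zp p pr_p).
Local Notation V := 'rV[K]_2.
Local Notation q := (p%:R^-1 : rat).
Implicit Types (u v w e c : V) (a : K) (L : set V).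

HB.instance Definition _ := isPointed.Build K 0.

Lemma std_lattice_compact : compact (@std_lattice p pr_p).
Proof. exact: (rV_compact (A := fun=> O) (fun=> @Zp_compact _ pr_p)). Qed.

Definition vnorm v : rat := Num.max (Qp_norm (v 0 0)) (Qp_norm (v 0 1)).

Lemma vnorm_leP v (r : rat) :
  reflect (Qp_norm (v 0 0) <= r /\ Qp_norm (v 0 1) <= r) (vnorm v <= r).
Proof. by rewrite ge_max; exact: andP. Qed.

Lemma vnorm_ge0 v : 0 <= vnorm v.
Proof. by rewrite le_max Qp_norm_ge0. Qed.

Lemma vnorm_eq0 v : (vnorm v == 0) = (v == 0).
Proof.
apply/eqP/eqP => [v0|->]; last by rewrite /vnorm !mxE Qp_norm0 maxxx.
have /vnorm_leP[] : vnorm v <= 0 by rewrite v0.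
rewrite !le_eqVlt !ltNge !Qp_norm_ge0 !orbF !Qp_norm_eq0 => /eqP h0 /eqP h1.
by apply: rV2P; rewrite mxE.
Qed.

Lemma vnorm0 : vnorm 0 = 0.
Proof. by apply/eqP; rewrite vnorm_eq0. Qed.

Lemma vnorm_gt0 v : (0 < vnorm v) = (v != 0).
Proof. by rewrite lt_def vnorm_ge0 andbT vnorm_eq0. Qed.

Lemma vnormZ a v : vnorm (a *: v) = Qp_norm a * vnorm v.
Proof. by rewrite /vnorm !mxE !Qp_normM maxr_pMr ?Qp_norm_ge0. Qed.

Lemma vnormD_le u v (r : rat) :
  vnorm u <= r -> vnorm v <= r -> vnorm (u + v) <= r.
Proof.
move=> /vnorm_leP[u0 u1] /vnorm_leP[v0 v1].
by apply/vnorm_leP; rewrite !mxE; split; exact: Qp_normD_le.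
Qed.

Lemma vnormN v : vnorm (- v) = vnorm v.
Proof. by rewrite /vnorm !mxE !Qp_normN. Qed.

Lemma vnormBC u v : vnorm (u - v) = vnorm (v - u).
Proof. by rewrite -opprB vnormN. Qed.

Lemma vnormD_eq u v : vnorm v < vnorm u -> vnorm (u + v) = vnorm u.
Proof.
move=> vu; apply/eqP; rewrite eq_le vnormD_le ?(ltW vu)//=.
rewrite leNgt; apply/negP => h.
have : vnorm (u + v + - v) <= Num.max (vnorm (u + v)) (vnorm v).
  by rewrite vnormD_le// ?vnormN le_max lexx ?orbT.
by rewrite addrK leNgt gt_max h vu.
Qed.

Lemma std_latticeE : @std_lattice p pr_p = [set v | vnorm v <= 1].
Proof.
apply/seteqP; split=> v /=; first by move=> h; apply/vnorm_leP; split; exact: h.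
by move=> /vnorm_leP[h0 h1] i; case: (ord2P i) => ->.
Qed.

Lemma vnorm_wedge u v : Qp_norm (wedge u v) <= vnorm u * vnorm v.
Proof.
by apply: Qp_normB_le; rewrite Qp_normM ler_pM ?Qp_norm_ge0// le_max lexx ?orbT.
Qed.

Lemma vnorm_val v : v != 0 -> exists2 a : K, a != 0 & Qp_norm a = vnorm v.
Proof.
rewrite -vnorm_gt0 => v0.
have [h|h] := leP (Qp_norm (v 0 0)) (Qp_norm (v 0 1)).
  exists (v 0 1); last by rewrite /vnorm (max_idPr h).
  by rewrite -Qp_norm_gt0; move: v0; rewrite /vnorm (max_idPr h).
exists (v 0 0); last by rewrite /vnorm (max_idPl (ltW h)).
by rewrite -Qp_norm_gt0; move: v0; rewrite /vnorm (max_idPl (ltW h)).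
Qed.

Lemma vnorm_normalize v : v != 0 -> exists2 a : K, a != 0 & vnorm (a *: v) = 1.
Proof.
move=> v0; have [a a0 av] := vnorm_val v0.
by exists a^-1; rewrite ?invr_eq0// vnormZ Qp_normV av mulVf ?vnorm_eq0.
Qed.

Lemma vnorm_qX v : v != 0 -> vnorm v <= 1 -> exists n, vnorm v = q ^+ n.
Proof. by move=> /vnorm_val[a a0 <-]; exact: Qp_norm_qX. Qed.

Lemma vnorm1_neq0 e : vnorm e = 1 -> e != 0.
Proof. by rewrite -vnorm_gt0 => ->. Qed.

(** A primitive vector extends to a basis of Zp^2: one coordinate of e is a unit, and c is supported
    on the other coordinate, with the inverse of this unit up to sign. *)
Lemma wedge_complement e : vnorm e = 1 ->
  exists2 c, vnorm c <= 1 & wedge e c = 1.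
Proof.
move=> e1; pose c0 : V := \row_j (if j == 0 then 0 else (e 0 0)^-1).
pose c1 : V := \row_j (if j == 0 then - (e 0 1)^-1 else 0).
have [h|h] := leP (Qp_norm (e 0 0)) (Qp_norm (e 0 1)).
  have h1 : Qp_norm (e 0 1) = 1 by rewrite -e1 /vnorm (max_idPr h).
  exists c1; first by apply/vnorm_leP;
    rewrite !mxE/= Qp_norm0 Qp_normN Qp_normV h1.
  rewrite /wedge !mxE/= mulr0 sub0r mulrN opprK divff//.
  by rewrite -Qp_norm_eq0 h1.
have h1 : Qp_norm (e 0 0) = 1 by rewrite -e1 /vnorm (max_idPl (ltW h)).
exists c0; first by apply/vnorm_leP; rewrite !mxE/= Qp_norm0 Qp_normV h1.
by rewrite /wedge !mxE/= mulr0 subr0 divff// -Qp_norm_eq0 h1.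
Qed.

Lemma vnorm_pX_le n v (r : rat) : vnorm v <= r -> vnorm (p%:R ^+ n *: v) <= r.
Proof.
move=> vr; rewrite vnormZ Qp_norm_pX (le_trans _ vr)// -[leRHS]mul1r.
by rewrite ler_wpM2r ?vnorm_ge0 ?qX_le1.
Qed.

Lemma ball_vnorm v (r : rat) u : 0 < r -> ball v r u <-> vnorm (v - u) < r.
Proof.
move=> r0; split=> [[_ h]|].
  have [h0 h1] := (h 0 0, h 0 1).
  by rewrite gt_max !mxE; apply/andP.
rewrite gt_max !mxE => /andP[h0 h1]; split; first exact: r0.
by move=> i k; rewrite [i]ord1; case: (ord2P k) => ->; [exact: h0|exact: h1].
Qed.

Lemma nbhs_vnorm v (A : set V) :
  nbhs v A <-> exists n, forall u, vnorm (v - u) < q ^+ n -> A u.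
Proof.
split=> [/nbhs_ballP[r /= r0 rA]|[n nA]].
  have [n nr] := qX_small pr_p r0; exists n => u un; apply: rA.
  by apply/ball_vnorm => //; exact: lt_trans nr.
apply/nbhs_ballP; exists (q ^+ n); first exact: qX_gt0.
by move=> u /(ball_vnorm _ _ (qX_gt0 pr_p n)); exact: nA.
Qed.

(** A multiple by p^n bringing v into the unit ball does the same for the whole ball of radius 1
    around v; finitely many such balls cover L. *)
Lemma compact_vnorm_bounded L : compact L ->
  exists n : nat, forall v, L v -> vnorm (p%:R ^+ n *: v) <= 1.
Proof.
move=> /compact_near_coveringP/(_ nat \oo (fun n v =>
  vnorm (p%:R ^+ n *: v) <= 1)).
case=> [v Lv|N _ h]; last by exists N => v Lv; exact: (h N (leqnn N)).
have [n nv] : exists n, vnorm (p%:R ^+ n *: v) <= 1.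
  have [->|v0] := eqVneq v 0; first by exists 0%N; rewrite scaler0 vnorm0.
  have v0' : 0 < (vnorm v)^-1 by rewrite invr_gt0 vnorm_gt0.
  have [n nv] := qX_small pr_p v0'; exists n.
  by rewrite vnormZ Qp_norm_pX -ler_pdivlMr ?vnorm_gt0// mul1r ltW.
exists ([set u | vnorm (v - u) < q ^+ 0], [set m | (n <= m)%N]).
  by split; [apply/nbhs_vnorm; exists 0%N|exists n].
move=> [u m] /= [vu nm]; rewrite -(subrK v u) scalerDr; apply: vnormD_le.
  by apply: vnorm_pX_le; rewrite vnormBC ltW// -(expr0 q).
rewrite vnormZ Qp_norm_pX (le_trans _ nv)// vnormZ Qp_norm_pX.
by rewrite ler_wpM2r ?vnorm_ge0 ?ler_qX.
Qed.

(* For primitive [e] this is Zp e + p^j Zp^2, the j-th lattice on the ray of the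
   line through [e]. *)
Definition strip e (j : nat) : set V :=
  [set v | vnorm v <= 1 /\ Qp_norm (wedge e v) <= q ^+ j].

Lemma strip_decomp e c j v : vnorm e = 1 -> vnorm c <= 1 -> wedge e c = 1 ->
  strip e j v <-> exists x y, [/\ v = x *: e + y *: c,
     Qp_norm x <= 1 & Qp_norm y <= q ^+ j].
Proof.
move=> e1 c1 ec; split=> [[v1 vj]|[x [y [-> x1 yj]]]].
  exists (wedge v c), (wedge e v); split=> //; first exact: wedge_decomp.
  by rewrite (le_trans (vnorm_wedge _ _))// mulr_ile1// vnorm_ge0.
split; last by rewrite wedge_coords.
apply: vnormD_le; rewrite vnormZ.
  by rewrite e1 mulr1.
by rewrite mulr_ile1 ?Qp_norm_ge0 ?vnorm_ge0// (le_trans yj)// qX_le1.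
Qed.

(** Completing e by c to a basis, det(e', v) = det(e', c) det(e, v) + det(e, e') det(c, v), and each
    product has a factor of norm at most q^j. *)
Lemma strip_sub e e' j : vnorm e = 1 -> vnorm e' = 1 ->
  Qp_norm (wedge e e') <= q ^+ j -> strip e j `<=` strip e' j.
Proof.
move=> e1 e'1 ee' v [v1 vj]; split; first exact: v1.
have [c c1 ec] := wedge_complement e1.
rewrite (wedge_decomp e' ec) wedgeDl !wedgeZl; apply: Qp_normD_le.
  rewrite Qp_normM -[leRHS]mul1r ler_pM ?Qp_norm_ge0//.
  by rewrite (le_trans (vnorm_wedge _ _))// e'1 mul1r.
rewrite Qp_normM -[leRHS]mulr1 ler_pM ?Qp_norm_ge0//.
by rewrite (le_trans (vnorm_wedge _ _))// mulr_ile1// vnorm_ge0.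
Qed.

Lemma strip_eq e e' j : vnorm e = 1 -> vnorm e' = 1 ->
  Qp_norm (wedge e e') <= q ^+ j -> strip e j = strip e' j.
Proof.
move=> e1 e'1 h; apply/seteqP; split; first exact: strip_sub.
by apply: strip_sub; rewrite // wedgeC Qp_normN.
Qed.

Lemma strip_self e j : vnorm e = 1 -> strip e j e.
Proof. by move=> e1; split; rewrite ?e1// wedgevv Qp_norm0 ltW// qX_gt0. Qed.

Lemma strip_unit e j a v : Qp_norm a = 1 -> strip e j (a *: v) <-> strip e j v.
Proof.
by move=> a1; rewrite /strip/= vnormZ wedgeZr Qp_normM a1 !mul1r.
Qed.

(** Multiples of the complement c detect the index j of a strip; this is how indices are compared
    below. *)
Lemma strip_scale_complement e c j k i : vnorm e = 1 -> vnorm c <= 1 ->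
  wedge e c = 1 ->
  strip e j (p%:R ^+ k *: (p%:R ^+ i *: c)) -> (j <= k + i)%N.
Proof.
move=> e1 c1 ec [_]; rewrite scalerA -exprD wedgeZr ec mulr1 Qp_norm_pX.
by rewrite ler_qX.
Qed.

Lemma strip_complement e c j : vnorm e = 1 -> vnorm c <= 1 -> wedge e c = 1 ->
  strip e j (p%:R ^+ j *: c).
Proof.
move=> e1 c1 ec; split; last by rewrite wedgeZr ec mulr1 Qp_norm_pX.
by rewrite vnormZ Qp_norm_pX mulr_ile1 ?vnorm_ge0 ?qX_le1// ltW// qX_gt0.
Qed.

Lemma strip_le e j k : (j <= k)%N -> strip e k `<=` strip e j.
Proof.
by move=> jk v [v1 vk]; split=> //; rewrite (le_trans vk)// ler_qX.
Qed.

Lemma strip_submodule e j : submodule (strip e j).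
Proof.
split=> [|u v [u1 uj] [v1 vj]|a v a1 [v1 vj]].
- by rewrite /strip/= vnorm0 /wedge !mxE !mulr0 subr0 Qp_norm0 ltW// qX_gt0.
- by split; [exact: vnormD_le|rewrite wedgeDr Qp_normD_le].
- split; first by rewrite vnormZ mulr_ile1// ?Qp_norm_ge0 ?vnorm_ge0.
  by rewrite wedgeZr Qp_normM -[leRHS]mul1r ler_pM ?Qp_norm_ge0.
Qed.

Lemma strip_lattice e j : vnorm e = 1 -> lattice (strip e j).
Proof.
move=> e1; split; last 2 first.
- exact: strip_submodule.
- move=> v; have [->|v0] := eqVneq v 0.
    exists 0, 0; last by rewrite scaler0.
    by case: (strip_submodule e j).
  have v0' : 0 < vnorm v by rewrite vnorm_gt0.
  have [n nv] := qX_small pr_p (divr_gt0 (qX_gt0 pr_p j) v0').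
  exists (p%:R ^- n), (p%:R ^+ n *: v); last first.
    by rewrite scalerA mulVf ?scale1r// Qp_pX_neq0.
  have h : vnorm (p%:R ^+ n *: v) <= q ^+ j.
    by rewrite vnormZ Qp_norm_pX -ler_pdivlMr ?vnorm_gt0// ltW.
  split; first by rewrite (le_trans h)// qX_le1.
  by rewrite (le_trans (vnorm_wedge _ _))// e1 mul1r.
apply: (subclosed_compact _ std_lattice_compact); last first.
  by rewrite std_latticeE => v [].
(* Both defining inequalities survive a perturbation of norm below q^j, so the strip is closed in
   the standard lattice. *)
move=> v /(_ [set u | vnorm (v - u) < q ^+ j])[].
  by apply/nbhs_vnorm; exists j.
move=> u [/= [u1 uj] vu]; have E : v = (v - u) + u by rewrite subrK.
split.
  by rewrite E vnormD_le// ltW// (lt_le_trans vu)// qX_le1.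
rewrite E wedgeDr Qp_normD_le// (le_trans (vnorm_wedge _ _))// e1 mul1r.
exact: ltW.
Qed.

(** * Normal form of lattices up to dilatation *)

Lemma dilateD a b L : dilate a (dilate b L) = dilate (a * b) L.
Proof.
rewrite /dilate; apply/seteqP; split=> v /=.
  by move=> [_ [w Lw <-] <-]; exists w => //; rewrite scalerA.
by move=> [w Lw <-]; exists (b *: w); [exists w|rewrite scalerA].
Qed.

Lemma dilate1 L : dilate 1 L = L.
Proof.
apply/seteqP; split=> v /=; first by move=> [w Lw <-]; rewrite scale1r.
by move=> Lv; exists v; rewrite ?scale1r.
Qed.

Lemma dilateP a L v : a != 0 -> dilate a L v <-> L (a^-1 *: v).
Proof.
move=> a0; split; first by move=> [w Lw <-]; rewrite scalerA mulVf// scale1r.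
by move=> h; exists (a^-1 *: v) => //; rewrite scalerA divff// scale1r.
Qed.

(** Elementary divisors in rank two: scale L so that a longest vector e becomes primitive, complete
    e by c, and let p^j be the largest power, in norm, that a multiple of c in the scaled lattice
    can have as coefficient. *)
Lemma lattice_strip L : lattice L ->
  exists a e j, [/\ a != 0, vnorm e = 1 & dilate a L = strip e j].
Proof.
move=> [cL [L0 LD LZ] Lspan].
have [n nL] := compact_vnorm_bounded cL.
have LV v : exists2 b : K, b != 0 & L (b *: v).
  have [a [w Lw vE]] := Lspan v.
  have [a0|a0] := eqVneq a 0.
    by exists 1; rewrite ?oner_eq0// scale1r vE a0 scale0r.
  by exists a^-1; rewrite ?invr_eq0// vE scalerA mulVf// scale1r.
(* Minimality of m makes v0 a vector of maximal norm in L; a nonzero multiple of any nonzero vector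
   shows that such norms exist. *)
have [m [v0 Lv0 v0m] mmin] : exists2 m, exists2 v, L v &
  vnorm (p%:R ^+ n *: v) = q ^+ m
   & forall k, (exists2 v, L v & vnorm (p%:R ^+ n *: v) = q ^+ k) -> (m <= k)%N.
  apply: ex_min_nat; pose u : V := const_mx 1.
  have [b b0 Lb] := LV u.
  have u0 : u != 0 by apply/eqP => /rowP/(_ 0)/eqP; rewrite !mxE oner_eq0.
  have [|k kE] := vnorm_qX _ (nL _ Lb); last by exists k, (b *: u).
  by rewrite scaler_eq0 negb_or Qp_pX_neq0 scaler_eq0 negb_or b0.
pose a : K := p%:R ^- m * p%:R ^+ n.
have a0 : a != 0 by rewrite mulf_neq0 ?invr_eq0 ?Qp_pX_neq0.
have aE v : vnorm (a *: v) = q ^- m * vnorm (p%:R ^+ n *: v).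
  by rewrite -scalerA vnormZ Qp_normV Qp_norm_pX.
have aL v : L v -> vnorm (a *: v) <= 1.
  move=> Lv; have [->|v00] := eqVneq v 0; first by rewrite scaler0 vnorm0.
  have [|k kE] := vnorm_qX _ (nL _ Lv).
    by rewrite scaler_eq0 negb_or v00 Qp_pX_neq0.
  have mk : (m <= k)%N by apply: mmin; exists v.
  by rewrite aE kE ler_pdivrMl ?qX_gt0// mulr1 ler_qX.
pose e := a *: v0.
have e1 : vnorm e = 1 by rewrite aE v0m mulVf// gt_eqF// qX_gt0.
have aK : a^-1 *: e = v0 by rewrite scalerA mulVf// scale1r.
have [c c1 ec] := wedge_complement e1.
have c0 : c != 0 by apply/eqP => cE; move/eqP: ec;
  rewrite cE /wedge !mxE !mulr0 subr0 eq_sym oner_eq0.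
have yc y : L (a^-1 *: (y *: c)) -> Qp_norm y <= 1.
  move=> /aL; rewrite scalerA divff// scale1r => h.
  have -> : y = wedge e (y *: c) by rewrite wedgeZr ec mulr1.
  by rewrite (le_trans (vnorm_wedge _ _))// e1 mul1r.
have [j [y Ly yj] jmin] : exists2 j, exists2 y, L (a^-1 *: (y *: c)) &
  Qp_norm y = q ^+ j
   & forall k, (exists2 y, L (a^-1 *: (y *: c)) & Qp_norm y = q ^+ k) ->
     (j <= k)%N.
  apply: ex_min_nat; have [b b0 Lb] := LV c.
  have Lab : L (a^-1 *: ((a * b) *: c)) by rewrite scalerA mulKf.
  have [|k kE] := Qp_norm_qX _ (yc _ Lab); first by rewrite mulf_neq0.
  by exists k, (a * b).
have y0 : y != 0 by rewrite -Qp_norm_gt0 yj qX_gt0.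
exists a, e, j; split=> //; apply/seteqP; split=> v.
  move=> /(dilateP _ _ a0) Lv.
  have v1 : vnorm v <= 1 by have := aL _ Lv; rewrite scalerA divff// scale1r.
  split=> //; have [->|w0] := eqVneq (wedge e v) 0.
    by rewrite Qp_norm0 ltW// qX_gt0.
  (* The component of v along e is an integral multiple of e, so removing it stays in the scaled
     lattice; minimality of j then bounds the remaining coefficient. *)
  have Lw : L (a^-1 *: (wedge e v *: c)).
    have -> : wedge e v *: c = v + (- wedge v c) *: e.
      by rewrite [X in X + _](wedge_decomp _ ec) scaleNr addrAC subrr add0r.
    rewrite scalerDr; apply: LD => //.
    rewrite scalerA [a^-1 * _]mulrC -scalerA aK; apply: LZ => //.
    by rewrite /Defs.Zp/= Qp_normN (le_trans (vnorm_wedge _ _))// mulr_ile1//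
      vnorm_ge0.
  have [k kE] := Qp_norm_qX w0 (yc _ Lw).
  by rewrite kE ler_qX//; apply: jmin; exists (wedge e v).
move=> /(strip_decomp _ _ e1 c1 ec)[x [z [-> x1 zj]]].
apply/dilateP => //; rewrite scalerDr; apply: LD.
  by rewrite scalerA [a^-1 * _]mulrC -scalerA aK; apply: LZ.
have -> : z = z / y * y by rewrite divfK.
rewrite scalerA mulrCA -scalerA -[_ *: c]scalerA; apply: LZ => //.
by rewrite /Defs.Zp/= Qp_normM Qp_normV yj ler_pdivrMr ?qX_gt0// mul1r.
Qed.

(** * Primitive generators of lines *)

Lemma projline_mk e : e != 0 -> exists l : projline pr_p, line l = <[e]>%VS.
Proof.
move=> e0; have d1 : \dim <[e]> = 1%N by rewrite dim_vline e0.
by exists (ProjLine d1).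
Qed.

Lemma projline_gen (l : projline pr_p) : exists e, vnorm e = 1 /\
  line l = <[e]>%VS.
Proof.
have v0 : vpick (line l) != 0.
  by rewrite vpick0 -dimv_eq0 dim_line.
have [a a0 a1] := vnorm_normalize v0; exists (a *: vpick (line l)); split=> //.
apply/eqP; rewrite eq_sym eqEdim dim_line dim_vline (vnorm1_neq0 a1) leqnn
  andbT.
by rewrite -memvE rpredZ// memv_pick.
Qed.

Definition gen (l : projline pr_p) : V := sval (cid (projline_gen l)).

Lemma vnorm_gen l : vnorm (gen l) = 1.
Proof. by rewrite /gen; case: cid => e []. Qed.

Lemma line_gen l : line l = <[gen l]>%VS.
Proof. by rewrite /gen; case: cid => e []. Qed.

Lemma mem_lineP l v : v \in line l -> exists2 a : K, v = a *: gen l &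
  Qp_norm a = vnorm v.
Proof.
rewrite line_gen => /vlineP[a ->]; exists a => //.
by rewrite vnormZ vnorm_gen mulr1.
Qed.

Lemma ray_latticeE l j :
  ray_lattice (@std_lattice p pr_p) l j = strip (gen l) j.
Proof.
have [c c1 ec] := wedge_complement (vnorm_gen l).
rewrite /ray_lattice std_latticeE; apply/seteqP; split=> v.
  move=> [u [/= /mem_lineP[a uE au] u1] [w w1 <-]].
  rewrite {u}uE vnormZ vnorm_gen mulr1 in u1 au *; split.
    apply: vnormD_le; rewrite vnormZ ?vnorm_gen ?mulr1//.
    by rewrite Qp_norm_pX mulr_ile1 ?vnorm_ge0 ?qX_le1// ltW// qX_gt0.
  rewrite wedgeDr !wedgeZr wedgevv mulr0 add0r Qp_normM Qp_norm_pX.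
  rewrite -[leRHS]mulr1 ler_pM ?Qp_norm_ge0// ?(ltW (qX_gt0 pr_p _))//.
  by rewrite (le_trans (vnorm_wedge _ _))// vnorm_gen mul1r.
move=> /(strip_decomp _ _ (vnorm_gen l) c1 ec)[x [y [-> x1 yj]]].
exists (x *: gen l); first split.
- by rewrite /= line_gen rpredZ// memv_line.
- by rewrite /= vnormZ vnorm_gen mulr1.
- exists ((p%:R ^- j * y) *: c); last by rewrite scalerA mulrA divff ?mul1r//
  Qp_pX_neq0.
  rewrite /= vnormZ mulr_ile1 ?vnorm_ge0 ?Qp_norm_ge0//
    Qp_normM Qp_normV Qp_norm_pX.
  by rewrite ler_pdivrMl ?qX_gt0// mulr1.
Qed.

End Plane.

(** * The tree *)

Section Tree.
Variables (p : nat) (pr_p : prime p).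
Local Notation K := (Qp pr_p).
Local Notation V := 'rV[K]_2.
Local Notation q := (p%:R^-1 : rat).
Implicit Types (l : projline pr_p) (v w : vertex pr_p) (j k n : nat)
  (L : set V).

Lemma vclass_inj : injective (@vclass p pr_p).
Proof.
move=> [a aP] [b bP] /= ab; move: aP bP; rewrite ab => aP bP.
by congr Vertex; exact: Prop_irrelevance.
Qed.

Lemma vclassE v L : vclass v L ->
  vclass v = [set dilate a L | a in [set a : K | a != 0]].
Proof.
have [M _ ->] := vclassP v; move=> [a /= a0 <-]; apply/seteqP; split=>
  N [b /= b0 <-].
  exists (b / a); first by rewrite /= mulf_neq0 ?invr_eq0.
  by rewrite dilateD divfK.
by exists (b * a); rewrite /= ?mulf_neq0// dilateD.
Qed.

Lemma vclass_eq v w L : vclass v L -> vclass w L -> v = w.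
Proof. by move=> vL wL; apply: vclass_inj;
  rewrite (vclassE vL) (vclassE wL). Qed.

Lemma rv_subproof l j : exists2 L : set V, lattice L &
  [set dilate a (strip (gen l) j) | a in [set a : K | a != 0]] =
  [set dilate a L | a in [set a : K | a != 0]].
Proof. by exists (strip (gen l) j) => //; exact/strip_lattice/vnorm_gen. Qed.

Definition rv l j : vertex pr_p := Vertex (rv_subproof l j).

Lemma vclass_rv l j : vclass (rv l j) (strip (gen l) j).
Proof. by exists 1; rewrite /= ?oner_eq0// dilate1. Qed.

(** The chordal distance on the projective line. Primitive generators are unique up to units, so the
    choice made by [gen] does not affect it. *)
Definition near_lines l l' j := Qp_norm (wedge (gen l) (gen l')) <= q ^+ j.

Lemma near_linesxx l j : near_lines l l j.
Proof. by rewrite /near_lines wedgevv Qp_norm0 ltW// qX_gt0. Qed.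

Lemma near_lines_sym l l' j : near_lines l l' j -> near_lines l' l j.
Proof. by rewrite /near_lines wedgeC Qp_normN. Qed.

Lemma near_lines_strip l l' j : near_lines l l' j ->
  strip (gen l) j = strip (gen l') j.
Proof. by apply: strip_eq; exact: vnorm_gen. Qed.

Lemma near_linesE l l' j : near_lines l l' j <-> strip (gen l) j (gen l').
Proof.
rewrite /near_lines; split=> [h|[]//].
by split=> //; rewrite vnorm_gen.
Qed.

Lemma near_lines_le l l' j k : (j <= k)%N -> near_lines l l' k ->
  near_lines l l' j.
Proof. by move=> jk /near_linesE h; apply/near_linesE; exact: strip_le h. Qed.

Lemma near_lines_trans l1 l2 l3 j :
  near_lines l1 l2 j -> near_lines l2 l3 j -> near_lines l1 l3 j.
Proof.
by move=> /near_lines_strip h /near_linesE; rewrite -h => /near_linesE.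
Qed.

Lemma vertex_rv v : exists l j, v = rv l j.
Proof.
have [L latL vL] := vclassP v.
have [a [e [j [a0 e1 aL]]]] := lattice_strip latL.
have [l lE] := projline_mk (vnorm1_neq0 e1).
have el : Qp_norm (wedge e (gen l)) <= q ^+ j.
  have := line_gen l; rewrite lE => h.
  have : gen l \in <[e]>%VS by rewrite h memv_line.
  by move=> /vlineP[b ->]; rewrite wedgeZr wedgevv mulr0 Qp_norm0 ltW// qX_gt0.
exists l, j; apply: (@vclass_eq _ _ (strip (gen l) j)); last exact: vclass_rv.
rewrite -(strip_eq e1 (vnorm_gen l) el) -aL vL.
by exists a.
Qed.

Lemma strip_leq l j k : strip (gen l) j `<=` strip (gen l) k -> (k <= j)%N.
Proof.
have [c c1 ec] := wedge_complement (vnorm_gen l).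
move=> /(_ _ (strip_complement j (vnorm_gen l) c1 ec)) h.
have := @strip_scale_complement _ _ (gen l) c k 0 j (vnorm_gen l) c1 ec.
by rewrite expr0 scale1r; exact.
Qed.

(** Both strips lie in the unit ball and contain a vector of norm 1, so the factor a is a unit, and
    units preserve strips. Each class thus contains only one strip. *)
Lemma dilate_strip l l' j j' (a : K) : a != 0 ->
  strip (gen l') j' = dilate a (strip (gen l) j) ->
  strip (gen l') j' = strip (gen l) j.
Proof.
move=> a0 E; have a1 : Qp_norm a = 1.
  apply/eqP; rewrite eq_le; apply/andP; split.
    have : strip (gen l') j' (a *: gen l).
      by rewrite E; exists (gen l) => //; exact/strip_self/vnorm_gen.
    by move=> []; rewrite vnormZ vnorm_gen mulr1.
  have := strip_self j' (vnorm_gen l'); rewrite E => -[w [w1 _] wE].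
  by rewrite -(vnorm_gen l') -wE vnormZ -[leRHS]mulr1 ler_wpM2l ?Qp_norm_ge0.
rewrite E; apply/seteqP; split=> v; first by move=> [w ws <-]; apply/strip_unit.
move=> vs; apply/dilateP => //; apply/strip_unit => //.
by rewrite Qp_normV a1 invr1.
Qed.

Lemma rv_eqP l l' j j' : rv l j = rv l' j' <-> j = j' /\ near_lines l l' j.
Proof.
split=> [E|[<- h]]; last first.
  apply: (@vclass_eq _ _ (strip (gen l) j)); first exact: vclass_rv.
  by rewrite (near_lines_strip h); exact: vclass_rv.
have : vclass (rv l j) (strip (gen l') j') by rewrite E; exact: vclass_rv.
rewrite (vclassE (vclass_rv l j)) => -[a a0 /esym/(dilate_strip a0) {}E].
have h : near_lines l l' j.
  by apply/near_linesE; rewrite -E; exact/strip_self/vnorm_gen.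
move: E; rewrite (near_lines_strip h) => E.
by split=> //; apply/eqP; rewrite eqn_leq !(@strip_leq l')// E.
Qed.

Lemma rv_near l l' j : near_lines l l' j -> rv l j = rv l' j.
Proof. by move=> h; apply/rv_eqP. Qed.

Lemma strip_sandwich l l' j j' :
  strip (gen l) j `<=` strip (gen l') j' ->
  dilate p%:R (strip (gen l') j') `<=` strip (gen l) j ->
  near_lines l l' j' /\ (j' <= j <= j'.+1)%N.
Proof.
move=> h1 h2.
have h : near_lines l l' j'.
  by apply/near_lines_sym/near_linesE/h1/strip_self/vnorm_gen.
split=> //; rewrite -(near_lines_strip h) in h1 h2.
rewrite (strip_leq h1)/=.
have [c c1 ec] := wedge_complement (vnorm_gen l).
have : strip (gen l) j (p%:R ^+ 1 *: (p%:R ^+ j' *: c)).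
  apply: h2; exists (p%:R ^+ j' *: c); last by rewrite expr1.
  exact: strip_complement (vnorm_gen l) c1 ec.
exact: strip_scale_complement (vnorm_gen l) c1 ec.
Qed.

Lemma adj_rv_sandwich l l' j j' : rv l j <> rv l' j' ->
  strip (gen l) j `<=` strip (gen l') j' ->
  dilate p%:R (strip (gen l') j') `<=` strip (gen l) j ->
  j = j'.+1 /\ rv l' j' = rv l j'.
Proof.
move=> ne h1 h2; have [h jj] := strip_sandwich h1 h2.
have E := rv_near h; split; last exact: esym E.
apply/eqP.
rewrite eqn_leq (andP jj).2 ltn_neqAle (andP jj).1 andbT /=.
by apply/eqP => jE; apply: ne; rewrite -jE E.
Qed.

(** Up to one scalar t, t L is contained in L' and contains p L', for strips L and L'. Their
    primitive vectors force 1/p <= |t| <= 1, so |t| is 1 or 1/p. In the first case L lies between p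
    L' and L'; in the second L' lies between p L and L, with the roles exchanged. *)
Lemma adj_rvP v w : adj v w ->
  exists l j, v = rv l j.+1 /\ w = rv l j \/ v = rv l j /\ w = rv l j.+1.
Proof.
have [l [j ->]] := vertex_rv v; have [l' [j' ->]] := vertex_rv w.
move=> [ne [L [M [a [vL wM a0 [h1 h2]]]]]].
move: vL wM; rewrite (vclassE (vclass_rv l j)) (vclassE (vclass_rv l' j')).
move=> [b /= b0 bL] [c /= c0 cM]; rewrite -{}bL -{}cM !dilateD in h1 h2.
pose t := a * b / c; have t0 : t != 0 by rewrite !mulf_neq0 ?invr_eq0.
have {}h2 (u : V) : strip (gen l) j u -> strip (gen l') j' (t *: u).
  move=> us; have /(dilateP _ _ c0) :
    dilate c (strip (gen l') j') ((a * b) *: u).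
    by apply: h2; exists u.
  by rewrite scalerA mulrC.
have {}h1 (u : V) : strip (gen l') j' u ->
  strip (gen l) j (t^-1 *: (p%:R *: u)).
  move=> us; have /(dilateP _ _ (mulf_neq0 a0 b0)) :
     dilate (a * b) (strip (gen l) j) ((p%:R * c) *: u).
    by apply: h1; exists u.
  have -> : t^-1 = (a * b)^-1 * c by rewrite /t invfM invrK.
  by rewrite [p%:R * c]mulrC !scalerA mulrA.
have t1 : Qp_norm t <= 1.
  have [] := h2 _ (strip_self j (vnorm_gen l)).
  by rewrite vnormZ vnorm_gen mulr1.
have tq : q <= Qp_norm t.
  have [] := h1 _ (strip_self j' (vnorm_gen l')).
  rewrite !vnormZ vnorm_gen mulr1 Qp_norm_p Qp_normV.
  by rewrite ler_pdivrMl ?Qp_norm_gt0// mulr1.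
have [tE|tlt] := eqVneq (Qp_norm t) 1.
  have [||-> ->] := @adj_rv_sandwich l l' j j' ne.
  - by move=> u /h2; rewrite strip_unit.
  - by move=> _ [u /h1 + <-]; apply: (strip_unit _ _ _ _).1;
    rewrite Qp_normV tE invr1.
  by exists l, j'; left.
have {tlt}tE : Qp_norm t = q.
  by apply/eqP; rewrite eq_le tq Qp_norm_lt1// lt_neqAle tlt.
have ptE : Qp_norm (t^-1 * p%:R : K) = 1.
  by rewrite Qp_normM Qp_normV tE Qp_norm_p mulVf// gt_eqF// q_gt0.
have [|||-> ->] := @adj_rv_sandwich l' l j' j.
- by move=> /esym.
- by move=> u /h1; rewrite scalerA strip_unit.
- move=> _ [u /h2 + <-]; have -> : p%:R *: u = (t^-1 * p%:R) *: (t *: u).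
    by rewrite scalerA mulrAC mulVf// mul1r.
  by move=> tu; apply/strip_unit.
by exists l', j; right.
Qed.

Lemma Qp_p_neq0 : p%:R != 0 :> K.
Proof. by rewrite -[p%:R]expr1 Qp_pX_neq0. Qed.

Lemma strip_pZ (e u : V) j : strip e j u -> strip e j.+1 (p%:R *: u).
Proof.
move=> [u1 uj]; split.
  by rewrite -[p%:R]expr1; exact: vnorm_pX_le.
by rewrite wedgeZr Qp_normM Qp_norm_p exprS ler_wpM2l ?q_ge0.
Qed.

Lemma rv_neq l j : rv l j <> rv l j.+1.
Proof. by move=> /rv_eqP[/eqP];
  rewrite -[X in X == _]addn0 -addn1 eqn_add2l. Qed.

Lemma adj_rvS l j : adj (rv l j) (rv l j.+1).
Proof.
split; first exact: rv_neq.
exists (strip (gen l) j), (strip (gen l) j.+1), p%:R; split.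
- exact: vclass_rv.
- exact: vclass_rv.
- exact: Qp_p_neq0.
- split=> _ [u us <-]; last exact: strip_pZ.
  by exists u => //; exact: strip_le us.
Qed.

Lemma adj_rvSn l j : adj (rv l j.+1) (rv l j).
Proof.
split; first by move=> /esym; exact: rv_neq.
exists (strip (gen l) j.+1), (strip (gen l) j), 1; rewrite oner_eq0 dilate1.
split=> //; [exact: vclass_rv|exact: vclass_rv|].
split; last exact: strip_le.
by move=> _ [u us <-]; exact: strip_pZ.
Qed.

Lemma adj_sym v w : adj v w -> adj w v.
Proof.
by move=> /adj_rvP[l [j [[-> ->]|[-> ->]]]]; [exact: adj_rvS|exact: adj_rvSn].
Qed.

Lemma vertex_height_subproof v : exists lj, v = rv lj.1 lj.2.
Proof. by have [l [j ->]] := vertex_rv v; exists (l, j). Qed.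

(** A chosen normal form: [height] is intrinsic, whereas [vline] is determined only modulo p^(height
    v). *)
Definition vline v := (sval (cid (vertex_height_subproof v))).1.
Definition height v := (sval (cid (vertex_height_subproof v))).2.

Lemma vertexE v : v = rv (vline v) (height v).
Proof. by rewrite /vline /height; case: cid. Qed.

Lemma height_rv l j : height (rv l j) = j.
Proof. by have /rv_eqP[<-] := vertexE (rv l j). Qed.

Lemma vline_rv l j : near_lines l (vline (rv l j)) j.
Proof. by have /rv_eqP[_] := vertexE (rv l j). Qed.

End Tree.

(** * The Lipschitz property of rational maps *)

Section RationalMaps.
Variables (p : nat) (pr_p : prime p).
Local Notation K := (Qp pr_p).
Local Notation V := 'rV[K]_2.
Local Notation q := (p%:R^-1 : rat).
Implicit Types (l : projline pr_p) (u v w : V) (j k n : nat) (x y : K).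

Lemma Qp_norm_sum_le n (F : 'I_n -> K) (r : rat) : 0 <= r ->
  (forall i, Qp_norm (F i) <= r) -> Qp_norm (\sum_(i < n) F i) <= r.
Proof.
move=> r0 Fr; elim/big_ind: _ => //; first by rewrite Qp_norm0.
by move=> x y; exact: Qp_normD_le.
Qed.

Lemma Qp_normXB x y n : Qp_norm x <= 1 -> Qp_norm y <= 1 ->
  Qp_norm (x ^+ n - y ^+ n) <= Qp_norm (x - y).
Proof.
move=> x1 y1; elim: n => [|n IH]; first by rewrite subrr Qp_norm0 Qp_norm_ge0.
have -> : x ^+ n.+1 - y ^+ n.+1 = x * (x ^+ n - y ^+ n) + (x - y) * y ^+ n.
  by rewrite !exprS; ring.
apply: Qp_normD_le; rewrite Qp_normM.
  by rewrite -[leRHS]mul1r ler_pM ?Qp_norm_ge0.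
rewrite -[leRHS]mulr1 ler_pM ?Qp_norm_ge0//.
by rewrite Qp_normX exprn_ile1 ?Qp_norm_ge0.
Qed.

Lemma Qp_norm_monomialB (a x y x' y' : K) (r : rat) i k :
  Qp_norm a <= 1 -> Qp_norm x <= 1 -> Qp_norm y <= 1 ->
  Qp_norm x' <= 1 -> Qp_norm y' <= 1 ->
  Qp_norm (x - x') <= r -> Qp_norm (y - y') <= r ->
  Qp_norm (a * x ^+ i * y ^+ k - a * x' ^+ i * y' ^+ k) <= r.
Proof.
move=> a1 x1 y1 x'1 y'1 xr yr.
have -> : a * x ^+ i * y ^+ k - a * x' ^+ i * y' ^+ k =
    (a * y ^+ k) * (x ^+ i - x' ^+ i) + (a * x' ^+ i) * (y ^+ k - y' ^+ k).
  by ring.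
have aX z n : Qp_norm z <= 1 -> Qp_norm (a * z ^+ n) <= 1.
  move=> z1; rewrite Qp_normM Qp_normX.
  by rewrite mulr_ile1 ?exprn_ile1 ?exprn_ge0 ?Qp_norm_ge0.
apply: Qp_normD_le; rewrite Qp_normM -[leRHS]mul1r.
  apply: ler_pM (Qp_norm_ge0 _) (Qp_norm_ge0 _) (aX _ _ y1) _.
  exact: le_trans (Qp_normXB _ x1 x'1) xr.
apply: ler_pM (Qp_norm_ge0 _) (Qp_norm_ge0 _) (aX _ _ x'1) _.
exact: le_trans (Qp_normXB _ y1 y'1) yr.
Qed.

(** Stated for all large exponents so that the finitely many coefficients of a polynomial can share
    one. *)
Lemma Qp_integral_multiple x : exists n, forall m, (n <= m)%N ->
  Qp_norm (p%:R ^+ m * x) <= 1.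
Proof.
have [->|x0] := eqVneq x 0; first by exists 0%N => m _; rewrite mulr0 Qp_norm0.
have x0' : 0 < (Qp_norm x)^-1 by rewrite invr_gt0 Qp_norm_gt0.
have [n nx] := qX_small pr_p x0'; exists n => m nm.
rewrite Qp_normM Qp_norm_pX -ler_pdivlMr ?Qp_norm_gt0// mul1r.
by rewrite (le_trans _ (ltW nx))// ler_qX.
Qed.

Lemma homog_eval_lipschitz d (a : {poly K}) : exists n, forall m, (n <= m)%N ->
  forall x y x' y' (r : rat),
  Qp_norm x <= 1 -> Qp_norm y <= 1 -> Qp_norm x' <= 1 -> Qp_norm y' <= 1 ->
  Qp_norm (x - x') <= r -> Qp_norm (y - y') <= r ->
  Qp_norm (p%:R ^+ m * (homog_eval d a x y - homog_eval d a x' y')) <= r.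
Proof.
have /choice[c cP] i := Qp_integral_multiple a`_i.
exists (\max_(i < d.+1) c i) => m cm x y x' y' r x1 y1 x'1 y'1 xr yr.
rewrite /homog_eval -sumrB mulr_sumr; apply: Qp_norm_sum_le => [|i].
  exact: le_trans (Qp_norm_ge0 _) xr.
rewrite mulrBr !mulrA; apply: Qp_norm_monomialB => //.
by apply: cP; rewrite (leq_trans _ cm)//; exact: (leq_bigmax i).
Qed.

Definition homog_map d (a b : {poly K}) v : V := \row_(j < 2)
  (if j == 0 then homog_eval d a (v 0 0) (v 0 1)
   else homog_eval d b (v 0 0) (v 0 1)).

Lemma homog_map_lipschitz d (a b : {poly K}) : exists n, forall u v,
  vnorm u <= 1 -> vnorm v <= 1 ->
  vnorm (p%:R ^+ n *: (homog_map d a b u - homog_map d a b v)) <= vnorm (u - v).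
Proof.
have [m ma] := homog_eval_lipschitz d a.
have [n nb] := homog_eval_lipschitz d b.
exists (maxn m n) => u v /vnorm_leP[u0 u1] /vnorm_leP[v0 v1].
have [uv0 uv1] : Qp_norm (u 0 0 - v 0 0) <= vnorm (u - v) /\
    Qp_norm (u 0 1 - v 0 1) <= vnorm (u - v).
  by have /vnorm_leP := lexx (vnorm (u - v)); rewrite !mxE.
apply/vnorm_leP; rewrite !mxE/=; split.
  by apply: ma => //; rewrite leq_maxl.
by apply: nb => //; rewrite leq_maxr.
Qed.

(** * From a Lipschitz lift on vectors to a Lipschitz map of lines *)

Section Lipschitz.
Variables (f : projline pr_p -> projline pr_p) (W : V -> V) (C : nat).
Hypothesis WL : forall u v, vnorm u <= 1 -> vnorm v <= 1 ->
  vnorm (p%:R ^+ C *: (W u - W v)) <= vnorm (u - v).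
Hypothesis fW : forall l v, v \in line l -> v != 0 -> line (f l) = <[W v]>%VS.

Let WB n u v : vnorm u <= 1 -> vnorm v <= 1 -> vnorm (u - v) <= q ^+ (C + n) ->
  vnorm (W u - W v) <= q ^+ n.
Proof.
move=> u1 v1 uv; have := le_trans (WL u1 v1) uv.
by rewrite vnormZ Qp_norm_pX exprD ler_pM2l// qX_gt0.
Qed.

Let W_neq0 v : v != 0 -> W v != 0.
Proof.
move=> v0; have [l lv] := projline_mk v0.
have := dim_line (f l); rewrite (fW _ v0) ?lv ?memv_line//.
by rewrite dim_vline; case: eqP.
Qed.

(** By the ultrametric inequality the norm of W is constant on primitive vectors close to a given
    one, where it is nonzero; compactness of the standard lattice makes the bound uniform. *)
Let W_bounded_below : exists n, forall v, vnorm v = 1 -> q ^+ n <= vnorm (W v).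
Proof.
have /compact_near_coveringP/(_ nat \oo
  (fun n v => vnorm v = 1 -> q ^+ n <= vnorm (W v))) :=
    @std_lattice_compact p pr_p.
case=> [v Lv|N _ h]; last first.
  exists N => v v1; apply: (h N (leqnn N)) => //.
  by rewrite std_latticeE/= v1.
rewrite std_latticeE/= in Lv.
have [v1|v1] := eqVneq (vnorm v) 1.
  have W0 : 0 < vnorm (W v) by rewrite vnorm_gt0 W_neq0// vnorm1_neq0.
  have [n nv] := qX_small pr_p W0.
  exists ([set u | vnorm (v - u) < q ^+ (C + n)], [set m | (n <= m)%N]).
    by split; [apply/nbhs_vnorm; exists (C + n)%N|exists n].
  move=> [u m] /= [vu nm] u1.
  have WB' : vnorm (W u - W v) < vnorm (W v).
    apply: le_lt_trans nv; apply: WB; [by rewrite u1|exact: Lv|].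
    by rewrite vnormBC ltW.
  rewrite -[W u](subrK (W v)) addrC vnormD_eq//.
  by rewrite (le_trans _ (ltW nv))// ler_qX.
(* Here |v| < 1, so no vector at distance less than 1 from v is primitive and the condition is
   empty. *)
exists ([set u | vnorm (v - u) < q ^+ 0], setT).
  by split; [apply/nbhs_vnorm; exists 0%N|exact: filterT].
move=> [u m] /= [vu _] u1; exfalso.
have vE : v = u + (v - u) by rewrite addrC subrK.
by move: v1; rewrite vE vnormD_eq ?u1 ?eqxx//.
Qed.

(** Rescale the generator of l' to e' close to e. Then det(W e, W e') is small because W e' - W e
    is, and it equals s t times the determinant of the generators of f l and f l', where |s| = |W e|
    and |t| = |W e'| >= q^m. The factor |s| cancels and the bound on |t| costs m. *)
Lemma lipschitz_near_lines : exists c, forall l l' j,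
  near_lines l l' (c + j) -> near_lines (f l) (f l') j.
Proof.
have [m mW] := W_bounded_below.
(* The successor makes the lines congruent modulo p even for j = 0, so that the coordinate x below
   is a unit. *)
exists (C + m).+1 => l l' j ll'.
have [c c1 ec] := wedge_complement (vnorm_gen l).
set e := gen l in ec *; set y := wedge e (gen l'); set x := wedge (gen l') c.
have E : gen l' = x *: e + y *: c := wedge_decomp _ ec.
have y1 : Qp_norm y < 1.
  by apply: le_lt_trans ll' _; rewrite -[ltRHS](expr0 q) ltr_qX.
have x1 : Qp_norm x = 1.
  have : Qp_norm x <= 1.
    by rewrite (le_trans (vnorm_wedge _ _))// vnorm_gen mul1r.
  rewrite le_eqVlt => /orP[/eqP//|xlt].
  have : vnorm (gen l') <= q.
    rewrite E vnormD_le// vnormZ.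
      by rewrite vnorm_gen mulr1 Qp_norm_lt1.
    by rewrite -[leRHS]mulr1 ler_pM ?Qp_norm_ge0 ?vnorm_ge0 ?Qp_norm_lt1.
  by rewrite vnorm_gen leNgt q_lt1.
have x0 : x != 0 by rewrite -Qp_norm_gt0 x1.
pose e' := x^-1 *: gen l'.
have e'1 : vnorm e' = 1 by rewrite vnormZ vnorm_gen Qp_normV x1 invr1 mulr1.
have e'E : e' - e = (y / x) *: c.
  by rewrite /e' E scalerDr !scalerA mulVf// scale1r addrAC subrr add0r mulrC.
have e'B : vnorm (e' - e) <= q ^+ (C + (m + j.+1)).
  rewrite e'E vnormZ Qp_normM Qp_normV x1 invr1 mulr1.
  rewrite (le_trans (ler_wpM2l (Qp_norm_ge0 _) c1))// mulr1.
  by rewrite addnA addnS -addSn.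
have e1 : vnorm e = 1 := vnorm_gen l.
have WW : vnorm (W e' - W e) <= q ^+ (m + j.+1) by apply: WB; rewrite ?e1 ?e'1.
have [s sE sN] : exists2 s : K, W e = s *: gen (f l) & Qp_norm s = vnorm (W e).
  apply: mem_lineP; rewrite (@fW l e) ?memv_line ?vnorm1_neq0//.
  by rewrite line_gen memv_line.
have [t tE tN] : exists2 t : K, W e' = t *: gen (f l') &
  Qp_norm t = vnorm (W e').
  apply: mem_lineP; rewrite (@fW l' e') ?memv_line ?vnorm1_neq0//.
  by rewrite line_gen rpredZ// memv_line.
have h : Qp_norm (wedge (W e) (W e')) <= Qp_norm s * q ^+ (m + j.+1).
  have -> : W e' = (W e' - W e) + W e by rewrite subrK.
  rewrite wedgeDr wedgevv addr0 (le_trans (vnorm_wedge _ _))//.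
  by rewrite sN ler_wpM2l ?vnorm_ge0.
move: h; rewrite {1}sE tE wedgeZr wedgeZl mulrCA Qp_normM.
have s0 : 0 < Qp_norm s by rewrite sN vnorm_gt0 W_neq0// vnorm1_neq0.
rewrite ler_pM2l// Qp_normM => h.
have := le_trans (ler_wpM2r (Qp_norm_ge0 (wedge (gen (f l)) (gen (f l')))) (mW _
  e'1)).
rewrite -tN => /(_ _ h); rewrite exprD ler_pM2l ?qX_gt0// => {}h.
by apply: le_trans h _; rewrite ler_qX.
Qed.

End Lipschitz.

Lemma rational_map_near_lines (f : projline pr_p -> projline pr_p) :
  rational_map f -> exists c, forall l l' j,
  near_lines l l' (c + j) -> near_lines (f l) (f l') j.
Proof.
move=> [a [b [_ /= fab]]].
have [C CW] := homog_map_lipschitz (maxn (size a) (size b)).-1 a b.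
exact: lipschitz_near_lines CW fab.
Qed.

End RationalMaps.

(** * Geometric realization *)

Section Realization.
Variables (R : realType) (p : nat) (pr_p : prime p).
Local Notation vertex := (vertex pr_p).
Local Notation realization := (realization R pr_p).
Implicit Types (v w : vertex) (x y : realization) (s t : R) (g : vertex -> R)
  (A C : set realization).

HB.instance Definition _ := gen_eqMixin vertex.
HB.instance Definition _ := gen_choiceMixin vertex.

Definition clamp s : R := Num.max (Num.min s 1) 0.

Lemma clamp_ge0le1 s : 0 <= clamp s <= 1.
Proof. by rewrite /clamp le_max lexx orbT ge_max ge_min lexx orbT ler01. Qed.

Lemma clamp_id s : 0 <= s <= 1 -> clamp s = s.
Proof. by move=> /andP[s0 s1]; rewrite /clamp (min_idPl s1) (max_idPl s0). Qed.

Lemma clampK s : clamp (clamp s) = clamp s.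
Proof. by rewrite clamp_id ?clamp_ge0le1. Qed.

Lemma clamp_continuous : continuous (clamp : R -> R).
Proof.
move=> s; apply: (@continuous_max R R (fun s => Num.min s 1) (cst 0)).
  by apply: (@continuous_min R R id (cst 1)) => //; exact: cvg_cst.
exact: cvg_cst.
Qed.

(** Degenerate edges are allowed, since the vertex map may collapse an edge. *)
Definition joined v w := v = w \/ adj v w.

Lemma joined_sym v w : joined v w -> joined w v.
Proof. by move=> [->|/adj_sym]; [left|right]. Qed.

Lemma seg_pt_subproof v w s : exists x, joined v w ->
  bary x = segment v w (clamp s).
Proof.
(* For vertices that are not joined the value is arbitrary. *)
have [vw|nvw] := pselect (joined v w); last by exists (vertex_pt R v).
have P : exists v' w' t', [/\ v' = w' \/ adj v' w', 0 <= t' <= 1 &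
    segment v w (clamp s) = segment v' w' t'].
  by exists v, w, (clamp s); split; rewrite ?clamp_ge0le1.
by exists (Realization P).
Qed.

(* The point at parameter [s] of the edge from [v] to [w]; the parameter is
   clamped to [0, 1] so that edges are paths on the whole line. *)
Definition seg_pt v w s : realization := sval (cid (seg_pt_subproof v w s)).

Lemma seg_ptE v w s : joined v w -> bary (seg_pt v w s) = segment v w (clamp s).
Proof. by rewrite /seg_pt; case: cid. Qed.

Lemma seg_pt_clamp v w s : joined v w -> seg_pt v w (clamp s) = seg_pt v w s.
Proof. by move=> vw; apply: bary_inj; rewrite !seg_ptE// clampK. Qed.

Lemma seg_ptC v w t : joined v w -> 0 <= t <= 1 ->
  seg_pt v w t = seg_pt w v (1 - t).
Proof.
move=> vw t01; apply: bary_inj; rewrite !seg_ptE//; last exact: joined_sym.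
rewrite !clamp_id//; last by case/andP: t01 => ? ?; apply/andP; split; lra.
by apply/funext => u; rewrite /segment; ring.
Qed.

Lemma vertex_pt_seg v w : joined v w -> vertex_pt R v = seg_pt v w 0.
Proof.
move=> vw; apply: bary_inj; rewrite seg_ptE// clamp_id ?lexx ?ler01//=.
by apply/funext => u; rewrite /segment; ring.
Qed.

Lemma vertex_pt_seg1 v w : joined v w -> vertex_pt R w = seg_pt v w 1.
Proof.
move=> vw; rewrite seg_ptC ?lexx ?ler01// subrr; apply: vertex_pt_seg.
exact: joined_sym.
Qed.

Lemma seg_ptxx v s : seg_pt v v s = vertex_pt R v.
Proof.
apply: bary_inj; rewrite seg_ptE/=; last by left.
by apply/funext => u; rewrite /segment; ring.
Qed.

Lemma edge_seg_pt v w : joined v w -> edge v w = seg_pt v w @` `[0, 1]%classic.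
Proof.
move=> vw; apply/seteqP; split=> x /=.
  move=> [t t01 xE]; exists t; first by rewrite /= in_itv.
  by apply: bary_inj; rewrite seg_ptE// clamp_id.
move=> [t]; rewrite /= in_itv /= => t01 <-; exists t => //.
by rewrite seg_ptE// clamp_id.
Qed.

Lemma realization_seg x : exists v w t, [/\ joined v w, 0 <= t <= 1 &
  x = seg_pt v w t].
Proof.
have [v [w [t [vw t01 xE]]]] := baryP x; exists v, w, t; split=> //.
by apply: bary_inj; rewrite xE seg_ptE// clamp_id.
Qed.

Lemma realization_ray x : exists l j t, 0 <= t <= 1 /\
  x = seg_pt (rv l j) (rv l j.+1) t.
Proof.
have [v [w [t [vw t01 ->]]]] := realization_seg x.
case: (vw) => [<-|/adj_rvP[l [j [[-> ->]|[-> ->]]]]].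
- have [l [j ->]] := vertex_rv v; exists l, j, 0.
  rewrite lexx ler01 seg_ptxx; split=> //; apply: vertex_pt_seg.
  by right; exact: adj_rvS.
- exists l, j, (1 - t); rewrite seg_ptC//; last by right; exact: adj_rvSn.
  by split=> //; case/andP: t01 => ? ?; apply/andP; split; lra.
- by exists l, j, t.
Qed.

(** Both sides are the sum of the values of g weighted by barycentric coordinates, taken over a
    finite list containing all four vertices. *)
Lemma segment_aff g v w t v' w' t' : segment v w t = segment v' w' t' ->
  (1 - t) * g v + t * g w = (1 - t') * g v' + t' * g w'.
Proof.
pose r := undup [:: v; w; v'; w'].
have indE u : u \in r -> \sum_(i <- r) (\1_[set u] i : R) * g i = g u.
  move=> ur; rewrite (bigD1_seq u) ?undup_uniq//= indicE mem_set// mul1r.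
  rewrite big1 ?addr0// => i iu; rewrite indicE memNset ?mul0r//.
  by move/eqP: iu.
have segE a b (c : R) : a \in r -> b \in r ->
    \sum_(i <- r) segment a b c i * g i = (1 - c) * g a + c * g b.
  move=> ar br; rewrite -(indE a ar) -(indE b br) !mulr_sumr -big_split /=.
  by apply: eq_bigr => i _; rewrite /segment; ring.
move=> E; rewrite -!segE ?mem_undup ?inE ?eqxx ?orbT//.
by apply: eq_bigr => i _; rewrite E.
Qed.

Lemma aff_subproof g x : exists a, forall v w s, joined v w ->
  x = seg_pt v w s ->
  a = (1 - clamp s) * g v + clamp s * g w.
Proof.
have [v [w [t [vw t01 xE]]]] := realization_seg x.
exists ((1 - t) * g v + t * g w) => v' w' s vw' xE'.
by apply: segment_aff; rewrite -seg_ptE// -xE' xE seg_ptE// clamp_id.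
Qed.

(* The extension of [g] to the realization that is affine on edges. *)
Definition aff g x : R := sval (cid (aff_subproof g x)).

Lemma affE g v w s : joined v w ->
  aff g (seg_pt v w s) = (1 - clamp s) * g v + clamp s * g w.
Proof. by rewrite /aff; case: cid => a /= h vw; exact: h. Qed.

Lemma aff_vertex g v : aff g (vertex_pt R v) = g v.
Proof. by rewrite -(seg_ptxx v 0) affE; [ring|left]. Qed.

Lemma bary_aff x v : bary x v = aff (fun u => \1_[set v] u) x.
Proof.
have [u [w [t [uw t01 ->]]]] := realization_seg x; rewrite affE// seg_ptE//.
have S (a b : vertex) : \1_[set a] b = \1_[set b] a :> R.
  by rewrite !indicE; congr (_%:R); congr nat_of_bool; apply/idP/idP;
    rewrite !inE => ->.
by rewrite /segment clamp_id// S (S w).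
Qed.

(** [clamp] retracts the line onto [0, 1], so a relatively open trace on the closed interval pulls
    back to an open subset of the line. This removes subspace topologies from what follows. *)
Lemma open_realizationP A :
  open A <-> forall v w, adj v w -> open (seg_pt v w @^-1` A).
Proof.
have E v w : adj v w ->
    [set t : R | exists2 x, A x & bary x = segment v w t] `&` `[0, 1]%classic =
    (seg_pt v w @^-1` A) `&` `[0, 1]%classic.
  move=> vw; apply/seteqP; split=> t /= [].
    rewrite in_itv /= => -[x Ax xE] t01; split=> //.
    have -> : seg_pt v w t = x by apply: bary_inj; rewrite seg_ptE ?clamp_id//;
      right.
    by [].
  rewrite in_itv /= => At t01; split=> //; exists (seg_pt v w t) => //.
  by rewrite seg_ptE ?clamp_id//; right.
rewrite -[open A]/(weak_open A); split=> oA v w vw; last first.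
  by apply/open_subspaceP; exists (seg_pt v w @^-1` A); [exact: oA|rewrite E].
have /open_subspaceP[U oU UE] := oA v w vw.
have -> : seg_pt v w @^-1` A = clamp @^-1` U.
  apply/seteqP; split=> s /=; rewrite -seg_pt_clamp; try by right.
    move=> h; have : (U `&` `[0, 1]%classic) (clamp s).
      by rewrite UE E//; split; rewrite //= in_itv /= clamp_ge0le1.
    by case.
  move=> h; have : (U `&` `[0, 1]%classic) (clamp s).
    by split; rewrite //= in_itv /= clamp_ge0le1.
  by rewrite UE E// => -[].
by have /continuousP := clamp_continuous; apply.
Qed.

Lemma seg_pt_continuous v w : joined v w -> continuous (seg_pt v w).
Proof.
move=> [<-|vw]; last by apply/continuousP => A /open_realizationP; exact.
by rewrite (_ : seg_pt v v = cst (vertex_pt R v));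
  [exact: cst_continuous|apply/funext => s; rewrite seg_ptxx].
Qed.

Lemma aff_continuous g : continuous (aff g).
Proof.
apply/continuousP => B oB; apply/open_realizationP => v w vw.
rewrite (_ : _ @^-1` _ =
    (fun s => (1 - clamp s) * g v + clamp s * g w) @^-1` B); last first.
  by apply/seteqP; split=> s /=; rewrite affE//; right.
have /continuousP : continuous (fun s => (1 - clamp s) * g v + clamp s * g w).
  move=> s; apply: cvgD; apply: cvgM; try exact: cvg_cst.
    by apply: cvgB; [exact: cvg_cst|exact: clamp_continuous].
  exact: clamp_continuous.
exact.
Qed.

(** Barycentric coordinates are affine extensions of indicators, hence continuous, and they separate
    points. *)
Lemma realization_hausdorff : hausdorff_space realization.
Proof.
move=> x y xy; apply: bary_inj; apply/funext => v; rewrite !bary_aff.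
apply: (@norm_hausdorff R R) => A B /aff_continuous Ax /aff_continuous By.
by have [z [Az Bz]] := xy _ _ Ax By; exists (aff (fun u => \1_[set v] u) z).
Qed.

(** * Connected components and compact subsets of the tree *)

Lemma edge_connected v w : joined v w -> connected (edge v w : set realization).
Proof.
move=> vw; rewrite edge_seg_pt//; apply: connected_continuous_connected.
  exact: segment_connected.
by apply: continuous_subspaceT; exact: seg_pt_continuous.
Qed.

Lemma sub_component A x y (B : set realization) : connected B -> B `<=` A ->
  B y -> connected_component A x y -> B `<=` connected_component A x.
Proof.
move=> cB BA By xy; rewrite (same_connected_component xy).
exact: connected_component_max.
Qed.

(** A small interval of an edge around a point of the component stays in A and has connected image,
    so it lies in the component. *)
Lemma component_open A x : open A -> open (connected_component A x).
Proof.
move=> oA; apply/open_realizationP => v w vw; rewrite openE => s /= xs.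
have cvw := seg_pt_continuous (or_intror vw : joined v w).
have As : A (seg_pt v w s) by exact: connected_component_sub xs.
have : nbhs s (seg_pt v w @^-1` A).
  by apply: open_nbhs_nbhs; split=> //; move/continuousP: cvw; apply.
move=> /nbhs_ballP[e /= e0 eA]; apply/nbhs_ballP; exists e => //= t st.
apply: (@sub_component A x _ (seg_pt v w @` ball s e) _ _ _ xs).
- apply: connected_continuous_connected; last exact: continuous_subspaceT.
  by apply/connected_intervalP; rewrite ball_itv; exact: interval_is_interval.
- by move=> _ [r /eA ? <-].
- by exists s => //; exact: ballxx.
- by exists t.
Qed.

Lemma compact_aff_bounded g C : compact C ->
  exists n : nat, forall x, C x -> aff g x < n%:R.
Proof.
move=> /compact_near_coveringP/(_ nat \oo (fun n x => aff g x < n%:R)).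
case=> [x Cx|N _ h]; last by exists N => x Cx; exact: (h N (leqnn N)).
pose n := Num.bound `|aff g x|.
exists ([set y | aff g y < n%:R], [set m | (n <= m)%N]); first split.
- apply: (@aff_continuous g x [set r : R | r < n%:R]).
  apply: open_nbhs_nbhs; split; first exact: open_lt.
  exact: le_lt_trans (ler_norm _) (archi_boundP (normr_ge0 _)).
- by exists n.
- by move=> [y m] /= [yn nm]; rewrite (lt_le_trans yn)// ler_nat.
Qed.

(** With points seen as probability measures on the vertices, F is the image measure under [phi]:
    its mass at v is the affine extension of the indicator of v composed with [phi]. This formula
    needs no choice of an edge through x. *)
Lemma pushforward (phi : vertex -> vertex) :
  (forall v w, joined v w -> joined (phi v) (phi w)) ->
  exists F : realization -> realization, forall v w s, joined v w ->
    F (seg_pt v w s) = seg_pt (phi v) (phi w) s.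
Proof.
move=> phiJ.
have /choice[F FE] x : exists y, forall v, bary y v = aff (fun u =>
  \1_[set v] (phi u)) x.
  have [v [w [t [vw t01 ->]]]] := realization_seg x.
  exists (seg_pt (phi v) (phi w) t) => u.
  by rewrite affE// bary_aff affE//; exact: phiJ.
exists F => v w s vw; apply: bary_inj; apply/funext => u.
by rewrite FE bary_aff !affE//; exact: phiJ.
Qed.

Lemma pushforward_continuous (phi : vertex -> vertex) (F : realization ->
  realization) :
  (forall v w, joined v w -> joined (phi v) (phi w)) ->
  (forall v w s, joined v w -> F (seg_pt v w s) = seg_pt (phi v) (phi w) s) ->
  continuous F.
Proof.
move=> phiJ FE; apply/continuousP => A oA; apply/open_realizationP => v w vw.
have vw' : joined v w by right.
rewrite (_ : _ @^-1` _ = seg_pt (phi v) (phi w) @^-1` A); last first.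
  by apply/seteqP; split=> s /=; rewrite FE.
by have /continuousP := seg_pt_continuous (phiJ _ _ vw'); apply.
Qed.

Lemma joined_rvS l j : joined (rv l j) (rv l j.+1 : vertex).
Proof. by right; exact: adj_rvS. Qed.

(* Once a component of the complement of [C] contains a vertex lying higher
   than [C], it contains the whole subtree above this vertex. *)
Lemma component_subtree C x l m :
  (forall y, C y -> aff (fun v => (height v)%:R) y < m%:R) ->
  connected_component (~` C) x (vertex_pt R (rv l m)) ->
  forall l' k s, near_lines l l' m -> (m <= k)%N ->
  connected_component (~` C) x (seg_pt (rv l' k) (rv l' k.+1) s).
Proof.
move=> Cm xm l' k s ll'.
(* Along such an edge the affine height is at least m, so the edge misses C; the component then
   spreads upwards one edge at a time. *)
have edgeC k' : (m <= k')%N -> edge (rv l' k') (rv l' k'.+1) `<=` ~` C.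
  move=> mk y; rewrite edge_seg_pt; last exact: joined_rvS.
  move=> [t t01 <-] /Cm; rewrite affE; last exact: joined_rvS.
  rewrite !height_rv -natr1 => h.
  have : m%:R <= k'%:R :> R by rewrite ler_nat.
  by have /andP[] := clamp_ge0le1 t; nra.
have edgeP k' : (m <= k')%N ->
    connected_component (~` C) x (vertex_pt R (rv l' k')) ->
    forall t, 0 <= t <= 1 ->
    connected_component (~` C) x (seg_pt (rv l' k') (rv l' k'.+1) t).
  move=> mk xk t t01; have J := joined_rvS l' k'.
  apply: (sub_component (edge_connected J) (edgeC _ mk) _ xk).
    rewrite edge_seg_pt//; exists 0; last by rewrite -vertex_pt_seg.
    by rewrite /= in_itv /= lexx ler01.
  by rewrite edge_seg_pt//; exists t => //; rewrite /= in_itv.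
move=> mk; rewrite -seg_pt_clamp; last exact: joined_rvS.
apply: (edgeP k) => //; last exact: clamp_ge0le1.
elim: k mk => [|k IH]; first by rewrite leqn0 => /eqP m0;
  rewrite -m0 -(rv_near ll').
rewrite leq_eqVlt => /orP[/eqP <-|mk]; first by rewrite -(rv_near ll').
have := edgeP k mk (IH mk) 1; rewrite -vertex_pt_seg1 ?ler01 ?lexx;
  last exact: joined_rvS.
exact.
Qed.

(* Removing the vertex [rv l n] cuts off the branch above [rv l n.+1]. *)
Lemma component_branch l n x :
  connected_component (~` [set vertex_pt R (rv l n)])
    (vertex_pt R (rv l n.+1)) x ->
  exists l' k t, [/\ near_lines l l' n.+1, (n <= k)%N &
    x = seg_pt (rv l' k) (rv l' k.+1) t].
Proof.
(* A separating function: 1 on the branch, 0 at the removed vertex, -1 elsewhere. Its affine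
   extension vanishes only at the removed vertex, because no edge joins the values 1 and -1. *)
pose phi v : R := if `[< (n < height v)%N /\
  near_lines l (vline v) n.+1 >] then 1
  else if v == rv l n then 0 else -1.
have phi1 l' k : (n < k)%N -> near_lines l l' n.+1 -> phi (rv l' k) = 1.
  move=> nk ll'; rewrite /phi; case: ifPn => // /asboolPn []; rewrite height_rv.
  split; first exact: nk.
  apply: near_lines_trans ll' _.
  by apply: near_lines_le (vline_rv _ _).
have phi1E l' k : 0 < phi (rv l' k) -> (n < k)%N /\ near_lines l l' n.+1.
  rewrite /phi; case: ifPn => [/asboolP[]|_].
    rewrite height_rv => nk h _; split; first exact: nk.
    apply: near_lines_trans h _.
    by apply/near_lines_sym; apply: near_lines_le (vline_rv _ _).
  by case: ifP => _; rewrite ?ltxx // ltr0N1.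
have phi0 : phi (rv l n) = 0.
  by rewrite /phi; case: ifPn => [/asboolP[]|_]; rewrite ?height_rv ?ltnn ?eqxx.
have phiE v : [\/ phi v = 1, v = rv l n | phi v = -1].
  rewrite /phi; case: ifP => _; first by constructor 1.
  by case: eqVneq => [->|_]; [constructor 2|constructor 3].
have aff0 y : aff phi y = 0 -> y = vertex_pt R (rv l n).
  have [l' [k [t [t01 ->]]]] := realization_ray y.
  have J := joined_rvS l' k; rewrite affE// clamp_id//.
  have [a1|a1] := eqVneq (phi (rv l' k)) 1.
    have [nk ll'] : (n < k)%N /\ near_lines l l' n.+1.
      by apply: phi1E; rewrite a1 ltr01.
    by rewrite a1 (phi1 l' k.+1) ?ltnS ?(ltnW nk)// => h; exfalso; move: h; lra.
  have [a|a|a] := phiE (rv l' k); first by rewrite a eqxx in a1.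
    have /rv_eqP[kn _] := a; rewrite a phi0 => h.
    have {h}-> : t = 0.
      have [b|b|b] := phiE (rv l' k.+1); move: h; rewrite b ?phi0; try lra.
      by move/rv_eqP: b => [] /eqP;
        rewrite -kn -[X in _ == X]addn0 -addn1 eqn_add2l.
    by rewrite -a; apply/esym/vertex_pt_seg.
  rewrite a; have [b|b|b] := phiE (rv l' k.+1) => h.
  - have [nk ll'] : (n < k.+1)%N /\ near_lines l l' n.+1.
      by apply: phi1E; rewrite b ltr01.
    move: nk; rewrite ltnS leq_eqVlt => /orP[/eqP nk|nk].
      move: a; rewrite -nk -(rv_near (near_lines_le (leqnSn n) ll')) phi0.
      by move=> h'; exfalso; move: h'; lra.
    by rewrite phi1 ?eqxx in a1.
  - have -> : t = 1 by move: h; rewrite b phi0; lra.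
    by rewrite -b; apply/esym/vertex_pt_seg1.
  - by exfalso; move: h; rewrite b; lra.
have phiS : aff phi (vertex_pt R (rv l n.+1)) = 1.
  by rewrite aff_vertex phi1//; exact: near_linesxx.
set D := connected_component _ _ => Dx.
have DS : D (vertex_pt R (rv l n.+1)).
  apply: connected_component_refl => /= h.
  by move: phiS; rewrite h aff_vertex phi0 => /esym/eqP; rewrite oner_eq0.
have pos : 0 < aff phi x.
  rewrite ltNge; apply/negP => neg.
  (* By connectedness, a value at most 0 on D besides the value 1 would force a zero, that is, the
     removed vertex. *)
  have : is_interval (aff phi @` D).
    apply/connected_intervalP; apply: connected_continuous_connected.
      exact: component_connected.
    by apply: continuous_subspaceT; exact: aff_continuous.
  move=> /(_ (aff phi x) 1 _ _ 0)[].
  - by exists x.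
  - by exists (vertex_pt R (rv l n.+1)).
  - by rewrite neg ler01.
  - move=> y Dy /aff0 yE; have := connected_component_sub Dy.
    by rewrite yE; apply.
have [l' [k [t [t01 xE]]]] := realization_ray x.
exists l', k, t; move: pos; rewrite xE affE; last exact: joined_rvS.
rewrite clamp_id// => pos.
(* A positive value on an edge requires an endpoint in the branch. The lower endpoint may be the
   removed vertex, hence only n <= k. *)
have [/phi1E[nk ll']|a] := ltP 0 (phi (rv l' k)).
  by split=> //; exact: ltnW.
have [/phi1E[nk ll']|b] := ltP 0 (phi (rv l' k.+1)); first by split.
by exfalso; case/andP: t01 => t0 t1; move: pos a b; nra.
Qed.

End Realization.

(** * The end compactification *)

Section EndCompactification.
Variables (R : realType) (p : nat) (pr_p : prime p).
Local Notation compactification := (compactification R pr_p).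
Local Notation realization := (realization R pr_p).
Implicit Types (z : compactification) (W : set compactification)
  (l : projline pr_p) (U : set realization) (j k n : nat).

(** Open sets are unions of finite intersections of subbasic sets, and filters are stable under
    finite intersections. *)
Lemma cvg_end_subbase (G : set_system compactification) z : Filter G ->
  (forall W, end_subbase W -> W z -> G W) -> G --> z.
Proof.
move=> FG Gz A /=; rewrite (@nbhsE compactification).
move=> [_ [[B sB <-] [D BD Dz] sUBA]].
rewrite nbhs_filterE; apply: filterS sUBA _; apply: (@filterS _ _ _ D).
  by move=> ? ?; exists D.
have /sB [E sE IED] := BD; rewrite -IED; apply: filter_bigI => W WE.
have /set_mem subW := sE _ WE; apply: Gz; first exact: subW.
by move: Dz; rewrite -IED => /(_ _ WE).
Qed.

Lemma nbhs_end_subbase z W : end_subbase W -> W z -> nbhs z W.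
Proof.
move=> subW Wz; rewrite (@nbhsE compactification); exists W => //; split=> //.
exists [set W]; last by rewrite bigcup_set1.
move=> _ ->; exists [fset W]%fset.
  by move=> ?; rewrite in_fset1 => /eqP->; exact/mem_set.
rewrite predeqE=> ?; split=> [|? ?]; first by apply; rewrite /= in_fset1.
by rewrite /= in_fset1 => /eqP->.
Qed.

Lemma end_inP l U : end_in l U <->
  exists N, forall j, (N <= j)%N -> U (vertex_pt R (rv l j)).
Proof.
split=> [[N _ NU]|[N NU]].
  exists N => j /NU[v]; rewrite ray_latticeE => vl.
  by rewrite (vclass_eq vl (vclass_rv l j)).
exists N => // j /NU Uj; exists (rv l j) => //.
by rewrite ray_latticeE; exact: vclass_rv.
Qed.

Lemma vertex_pt_seg_inv (u v w : vertex pr_p) (s : R) : joined v w ->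
  vertex_pt R u = seg_pt v w s -> u = v \/ u = w.
Proof.
move=> vw E; apply: contrapT => /not_orP[uv uw].
have := aff_vertex (fun x => (x == u)%:R : R) u.
have /negPf vu : v != u by apply/eqP => /esym.
have /negPf wu : w != u by apply/eqP => /esym.
rewrite E (affE _ _ vw) eqxx vu wu => /eqP.
by rewrite !mulr0 addr0 eq_sym oner_eq0.
Qed.

Lemma near_lines0 l l' : near_lines l l' 0.
Proof. by rewrite /near_lines expr0 (le_trans (vnorm_wedge _ _))//
  !vnorm_gen mulr1. Qed.

(** * Extension of a Lipschitz map of ends to the compactified tree *)

Section Extension.
Variables (f : projline pr_p -> projline pr_p) (c : nat).
Hypothesis fL : forall l l' j, near_lines l l' (c + j) ->
  near_lines (f l) (f l') j.

Definition vertex_map (v : vertex pr_p) : vertex pr_p :=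
  rv (f (vline v)) (height v - c).

Lemma vertex_map_rv l j : vertex_map (rv l j) = rv (f l) (j - c).
Proof.
rewrite /vertex_map height_rv; apply: rv_near; apply: near_lines_sym.
have [cj|jc] := leqP c j; last first.
  (* Below height c the image is the standard vertex, where all rays start. *)
  by rewrite (eqP (ltnW jc : (j - c == 0)%N)); exact: near_lines0.
by apply: fL; rewrite subnKC//; exact: vline_rv.
Qed.

Lemma vertex_map_joined v w : joined v w ->
  joined (vertex_map v) (vertex_map w).
Proof.
have mapS l j : joined (vertex_map (rv l j)) (vertex_map (rv l j.+1)).
  rewrite !vertex_map_rv; have [cj|jc] := leqP c j.
    by rewrite subSn//; exact: joined_rvS.
  left; rewrite (eqP (ltnW jc : (j - c == 0)%N)).
  by rewrite (eqP (jc : (j.+1 - c == 0)%N)).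
move=> [->|/adj_rvP[l [j [[-> ->]|[-> ->]]]]]; first by left.
  exact: joined_sym.
exact: mapS.
Qed.

Variable F : realization -> realization.
Hypothesis FE : forall v w s, joined v w ->
  F (seg_pt v w s) = seg_pt (vertex_map v) (vertex_map w) s.

Definition compactification_map z : compactification :=
  match z with Inner x => Inner (F x) | End l => End (f l) end.

(** Only continuity at an end l towards a component U needs an argument: high enough, U contains the
    whole subtree above a vertex of the ray to f l, and the branch cut off at a vertex of the ray to
    l, c levels higher, maps into that subtree. *)
Lemma compactification_map_continuous : continuous compactification_map.
Proof.
have Fcont : continuous F := pushforward_continuous vertex_map_joined FE.
have inner x (U : set realization) : open U -> U (F x) ->
    nbhs (Inner x : compactification) [set z | exists2 y, z = Inner y &
      U (F y)].
  move=> oU Ux; apply: filterS (nbhs_end_subbase (W :=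
    Inner @` (F @^-1` U)) _ _).
  - by move=> _ [y Uy <-]; exists y.
  - left; exists (F @^-1` U) => //=.
    by have /continuousP := Fcont; apply.
  - by exists x.
move=> z; have FG : Filter (compactification_map @ z) by apply: fmap_filter;
  exact: nbhs_filter.
apply: cvg_end_subbase => W {FG}[[A oA <-]|[C [x0 [cC Cx0 ->]]]].
  (* Subbasic sets of this kind contain no end, so z is a point of the tree. *)
  case: z => [x|l] [y //= Ay [yE]]; apply: filterS (inner x A oA _).
    by move=> _ [x' -> Ax'] /=; exists (F x').
  by rewrite -yE.
set U := connected_component _ _.
have oU : open U.
  by apply: component_open; apply: closed_openC;
    exact: (compact_closed (@realization_hausdorff R p pr_p) cC).
case: z => [x|l] /=.
  move=> Ux; apply: filterS (inner x U oU Ux).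
  by move=> _ [x' -> Ux'].
move=> /end_inP[N NU].
have [H HC] := compact_aff_bounded (fun v => (height v)%:R) cC.
(* From level m on, the ray to f l lies in U and above C; the shift by c makes level n map to level
   m. *)
pose m := maxn N H; pose n := (c + m)%N.
have Cm y : C y -> aff (fun v => (height v)%:R) y < m%:R :> R.
  by move=> /HC yH; rewrite (lt_le_trans yH)// ler_nat leq_maxr.
have Um : U (vertex_pt R (rv (f l) m)) by apply: NU; rewrite leq_maxl.
have sub := component_subtree Cm Um.
set P := vertex_pt R (rv l n); set Q := vertex_pt R (rv l n.+1).
have PQ : P <> Q.
  move=> PQ; have := congr1 (aff (fun v => (height v)%:R : R)) PQ.
  rewrite !aff_vertex !height_rv => /eqP; rewrite eqr_nat.
  by rewrite -[X in X == _]addn0 -addn1 eqn_add2l.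
pose D := connected_component (~` [set P]) Q.
have DQ : D Q by apply: connected_component_refl => /= /esym.
have Dl : end_in l D.
  apply/end_inP; exists n.+1 => j nj.
  rewrite (vertex_pt_seg R (joined_rvS l j)).
  apply: (component_subtree (m := n.+1) _ DQ 0 (near_linesxx l _) nj).
  by move=> _ ->; rewrite aff_vertex height_rv ltr_nat.
have subD : end_subbase (with_ends D).
  right; exists [set P], Q; split=> //; first exact: compact_set1.
  by move=> /= /esym.
apply: filterS (nbhs_end_subbase (z := End l) subD Dl) => -[x|l'] /=.
  move=> /component_branch[l' [k [t [ll' nk ->]]]].
  rewrite FE; last exact: joined_rvS.
  have ck : (c <= k)%N by rewrite (leq_trans _ nk)// leq_addr.
  rewrite !vertex_map_rv subSn//; apply: sub.
    by apply: fL; exact: near_lines_le ll'.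
  by rewrite leq_subRL.
move=> /end_inP[N' /(_ (maxn N' n.+1) (leq_maxl _ _)) /component_branch].
(* A vertex of the ray to l' at level at least n + 1 lies on an edge of the branch, hence is an
   endpoint of that edge; this gives the congruence of l' and l'' modulo p^(n+1). *)
move=> [l'' [k [t [ll'' nk]]]] /vertex_pt_seg_inv - /(_ (joined_rvS _ _)) E.
have {E}l''l' : near_lines l'' l' n.+1.
  apply/near_lines_sym; apply: (@near_lines_le _ _ _ _ _ (maxn N' n.+1)).
    exact: leq_maxr.
  by case: E => /rv_eqP[].
have fll' : near_lines (f l) (f l') m.
  by apply: fL; apply: near_lines_le (near_lines_trans ll'' l''l').
apply/end_inP; exists m => j mj.
by rewrite (vertex_pt_seg R (joined_rvS (f l') j)); exact: sub.
Qed.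

Lemma compactification_map_edge v w : joined v w ->
  compactification_map @` (Inner @` edge v w) =
  Inner @` edge (vertex_map v) (vertex_map w).
Proof.
move=> vw; rewrite !edge_seg_pt//; last exact: vertex_map_joined.
apply/seteqP; split=> z /=.
  move=> [_ [_ [t t01 <-] <-] <-]; exists (F (seg_pt v w t)) => //.
  by exists t => //; rewrite FE.
move=> [_ [t t01 <-] <-]; exists (Inner (seg_pt v w t)); last by rewrite /= FE.
by exists (seg_pt v w t) => //; exists t.
Qed.

End Extension.

Lemma edgexx (v : vertex pr_p) : edge v v = [set vertex_pt R v].
Proof.
rewrite edge_seg_pt; last by left.
apply/seteqP; split=> x /=; first by move=> [t _ <-]; rewrite seg_ptxx.
move=> ->; exists 0; last by rewrite seg_ptxx.
by rewrite /= in_itv /= lexx ler01.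
Qed.

End EndCompactification.

Theorem corollary4p5 (R : realType) (p : nat) (pr_p : prime p)
    (f : projline pr_p -> projline pr_p) :
  rational_map f ->
  exists F : compactification R pr_p -> compactification R pr_p,
    [/\ continuous F,
        forall x, exists y, F (Inner x) = Inner y,
        forall l, F (End l) = End (f l),
        forall v, exists w, F (Inner (vertex_pt R v)) = Inner (vertex_pt R w) &
        forall v w, adj v w ->
          (exists v' w', adj v' w' /\
             F @` (Inner @` edge v w) = Inner @` edge v' w') \/
          (exists u, F @` (Inner @` edge v w) = [set Inner (vertex_pt R u)])].
Proof.
move=> /rational_map_near_lines[c fL].
have [F FE] := pushforward R (vertex_map_joined fL).
exists (compactification_map f F); split.
- exact: compactification_map_continuous fL _ FE.
- by move=> x; exists (F x).
- by [].
- move=> v; exists (vertex_map f c v).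
  have vv : joined v v by left.
  by rewrite /= -(seg_ptxx v (0 : R)) (FE _ _ _ vv) seg_ptxx.
- move=> v w vw; have J : joined v w by right.
  rewrite (compactification_map_edge fL FE J).
  (* The edge collapses exactly when its endpoints have the same image. *)
  have [E|vw'] := vertex_map_joined fL J; last first.
    by left; exists (vertex_map f c v), (vertex_map f c w).
  by right; exists (vertex_map f c v); rewrite -E edgexx image_set1.
Qed.
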